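(* Let $p\ge1$, $k\ge1$, $r\in\{0,\dots,p-1\}$, $q=p-r$, and suppose the model $(c,\{f_i\}_{i=0}^k)$ belongs to $\mathcal M_r$ (see context), with associated $\alpha,\mu,\theta$. For $\tau\in\mathbb N$, a state $\mathfrak z=(\mathfrak z_{(1)}^\top,\dots,\mathfrak z_{(k)}^\top)^\top\in\mathbb R^{kp}$ and $u\in\mathbb R^p$, let $z_t(u;\mathfrak z)$, $t\ge\tau$, be defined by $z_{\tau-i}=\mathfrak z_{(i)}$ for $i=1,\dots,k$ and $f_0(z_t)=c+\sum_{i=1}^kf_i(z_{t-i})+u_t$ for $t\ge\tau$, where $u_\tau=u$ and $u_t=0$ for $t\ge\tau+1$. Let $\mathscr M_\mu=\{z\in\mathbb R^p:\theta(z)=-\mu\}$ and $\bar h(\mathfrak z)=f_0(\mathfrak z_{(1)})-\sum_{i=1}^{k-1}g_i(\mathfrak z_{(i+1)})$. Then: (1) for every $(u,\mathfrak z)\in\mathbb R^p\times\mathbb R^{kp}$, as $t\to\infty$, $$z_t(u;\mathfrak z)\to z_\infty(u;\mathfrak z)\defeq\chi^{-1}\begin{bmatrix}\alpha_\perp^\top[\bar h(\mathfrak z)+u]\\-\mu\end{bmatrix}\in\mathscr M_\mu;$$ (2) for any $(z,\mathfrak z)\in\mathscr M_\mu\times\mathbb R^{kp}$, the $r$-dimensional affine subspace $\mathscr U(z;\mathfrak z)\defeq\operatorname{span}\alpha+[h(z)-\bar h(\mathfrak z)]$ is the domain of attraction for $z$, given $\mathfrak z$; and hence $\mathscr M_\mu$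 is strictly stable.
   Context: Model: for $c\in\mathbb R^p$ and maps $f_0,\dots,f_k:\mathbb R^p\to\mathbb R^p$ with $f_i(0)=0$, the nonlinear VAR($k$) is $f_0(z_t)=c+\sum_{i=1}^k f_i(z_{t-i})+u_t$. (When $k=1$, blocks indexed by $1,\dots,k-1$ are empty.) Define $g_j(z)=-\sum_{i=j+1}^k f_i(z)$ ($j=0,\dots,k-1$); $\pi(z)=-f_0(z)+\sum_{i=1}^k f_i(z)$; $\mathbf g(z)=(g_1(z)^\top,\dots,g_{k-1}(z)^\top)^\top$. $D\in\mathbb R^{p(k-1)\times p(k-1)}$ has $-I_p$ diagonal blocks, $I_p$ blocks immediately above the diagonal, zeros elsewhere; $E=(I_p,0_{p\times p(k-2)})^\top$. For $\alpha\in\mathbb R^{p\times r}$ of rank $r$, $\alpha_\perp$ is $p\times(p-r)$ of rank $p-r$ with $\alpha_\perp^\top\alpha=0$; $\boldsymbol\alpha=\begin{bmatrix}\alpha & E^\top\\ 0 & I_{p(k-1)}\end{bmatrix}$. For $\theta:\mathbb R^p\to\mathbb R^r$, $\boldsymbol\theta(z)=(\theta(z)^\top,\mathbf g(z)^\top)^\top$, $\mathbf D_0=\begin{bmatrix}0_{r\times p}&0\\0&D\end{bmatrix}$. Joint spectral radius: $\rho_{JSR}(\mathcal A)=\limsup_{t}\sup\{\rho(M_1\cdots M_t)^{1/t}:M_s\in\mathcal A\}$. Class $\mathcal M_r$: the model belongs to $\mathcal M_r$ if for some $\alpha\in\mathbb R^{p\times r}$ of rank $r$, $\bar b<\infty$,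 $\bar\rho<1$: (i) $f_0$ is a homeomorphism of $\mathbb R^p$; (ii) there exist $\mu\in\mathbb R^r$, $\theta:\mathbb R^p\to\mathbb R^r$ with $c=\alpha\mu$, $\pi=\alpha\theta$; (iii) there is a closed $\mathcal B\subset\mathbb R^{kp\times[p(k-1)+r]}$ with $\max_{\mathcal B}\|\boldsymbol\beta\|\le\bar b$ and $\rho_{JSR}(\{I+\boldsymbol\beta^\top\boldsymbol\alpha:\boldsymbol\beta\in\mathcal B\})\le\bar\rho$, such that for all $\mathbf z=(z^\top,\boldsymbol\zeta^\top)^\top,\mathbf z'=(z'^\top,\boldsymbol\zeta'^\top)^\top\in\mathbb R^{kp}$ some $\boldsymbol\beta\in\mathcal B$ satisfies $[\boldsymbol\theta(f_0^{-1}(z))+\mathbf D_0\mathbf z]-[\boldsymbol\theta(f_0^{-1}(z'))+\mathbf D_0\mathbf z']=\boldsymbol\beta^\top(\mathbf z-\mathbf z')$. Define $h(z)=f_0(z)-\sum_{i=1}^{k-1}g_i(z)$, $\psi=\alpha_\perp^\top h$, $\chi(z)=(\psi(z)^\top,\theta(z)^\top)^\top$. Stability notions (with $z_t(u;\mathfrak z)$ as in the claim): $\mathcal S\subset\mathbb R^p$ is stable if for every $(u,\mathfrak z)$ there is $z_\infty\in\mathcal S$ with $z_t(u;\mathfrak z)\to z_\infty$. $z_\infty\in\mathbb R^p$ is a non-trivial attractor if for every $\mathfrak z$ there is a non-empty set $\mathscr U(z_\infty;\mathfrak z)\subset\mathbb R^p$ with $z_t(u;\mathfrak z)\to z_\infty$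 for all $u\in\mathscr U(z_\infty;\mathfrak z)$; this set is called the domain of attraction for $z_\infty$ given $\mathfrak z$. $\mathcal S$ is strictly stable if it is stable and contains only non-trivial attractors. *)

(* Defs.v *)
From HB Require Import structures.
From mathcomp Require Import all_boot all_order all_algebra.
From mathcomp Require Import all_classical all_reals all_analysis.
From mathcomp Require complex.
Import complex.ComplexEqChoice complex.ComplexField.
Set Implicit Arguments. Unset Strict Implicit. Unset Printing Implicit Defensive.
Import Order.TTheory GRing.Theory Num.Theory.
Import numFieldNormedType.Exports.
Local Open Scope classical_set_scope.
Local Open Scope ring_scope.

Section NVAR.
Variable R : realType.

Definition complex_eigenvalues n (M : 'M[R]_n) : set (complex.complex R) :=
  [set l | root (map_poly (fun x : R => complex.Complex x 0) (char_poly M)) l].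

Definition cmod (l : complex.complex R) : R :=
  Num.sqrt (complex.Re l ^+ 2 + complex.Im l ^+ 2).

(* spectral radius rho(M) = max |lambda| over the complex eigenvalues of M
   (for n = 0 there is no eigenvalue and the value is sup set0 = 0) *)
Definition spectral_radius n (M : 'M[R]_n) : R :=
  sup [set cmod l | l in complex_eigenvalues M].

Definition mxprod n t (Ms : 'I_t -> 'M[R]_n) : 'M[R]_n :=
  \big[mulmx/1%:M]_(i < t) Ms i.

Definition jsr n (A : set 'M[R]_n) : \bar R :=
  limn_esup (fun t : nat =>
    ereal_sup [set ((spectral_radius (mxprod Ms)) `^ (t.+1%:R^-1))%:E
              | Ms in [set Ms : 'I_t.+1 -> 'M[R]_n | forall s, A (Ms s)]]).

(* f : nat -> R^p -> R^p, only f 0, ..., f k matter. *)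

Definition gfun p k (f : nat -> 'cV[R]_p -> 'cV[R]_p) (j : nat) (z : 'cV[R]_p)
  : 'cV[R]_p := - \sum_(j.+1 <= i < k.+1) f i z.

Definition pifun p k (f : nat -> 'cV[R]_p -> 'cV[R]_p) (z : 'cV[R]_p)
  : 'cV[R]_p := - f 0%N z + \sum_(1 <= i < k.+1) f i z.

(* bold g(z) = (g_1(z)^T, ..., g_{k-1}(z)^T)^T, block a (0-based) at rows a*p..a*p+p-1 *)
Definition gvec p k (f : nat -> 'cV[R]_p -> 'cV[R]_p) (z : 'cV[R]_p)
  : 'cV[R]_((k.-1) * p) :=
  (mxvec (\matrix_(a < k.-1, s < p) gfun k f a.+1 z s ord0))^T.

(* D : -I_p diagonal blocks, I_p blocks immediately above the diagonal *)
Definition Dmat p k : 'M[R]_((k.-1) * p) :=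
  \matrix_(i < (k.-1) * p, j < (k.-1) * p)
    (if i == j then -1 else if (nat_of_ord j == (nat_of_ord i + p)%N) then 1 else 0).

Definition Emat p k : 'M[R]_((k.-1) * p, p) :=
  \matrix_(i < (k.-1) * p, j < p) ((nat_of_ord i == nat_of_ord j)%:R).

Definition balpha p k r (alpha : 'M[R]_(p, r))
  : 'M[R]_(p + (k.-1) * p, r + (k.-1) * p) :=
  block_mx alpha (Emat p k)^T 0 1%:M.

Definition bD0 p k r : 'M[R]_(r + (k.-1) * p, p + (k.-1) * p) :=
  block_mx 0 0 0 (Dmat p k).

Definition btheta p k r (f : nat -> 'cV[R]_p -> 'cV[R]_p)
  (theta : 'cV[R]_p -> 'cV[R]_r) (z : 'cV[R]_p) : 'cV[R]_(r + (k.-1) * p) :=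
  col_mx (theta z) (gvec k f z).

Definition homeomorphism_with p (f0 f0inv : 'cV[R]_p -> 'cV[R]_p) : Prop :=
  cancel f0 f0inv /\ cancel f0inv f0 /\ continuous f0 /\ continuous f0inv.

Definition hfun p k (f : nat -> 'cV[R]_p -> 'cV[R]_p) (z : 'cV[R]_p) : 'cV[R]_p :=
  f 0%N z - \sum_(1 <= i < k) gfun k f i z.

(* a state frak z = (z_(1),...,z_(k)) in R^{kp} is given as zz : 'I_k -> R^p,
   zz i = z_(i+1).  hbar(zz) = f_0(z_(1)) - sum_{i=1}^{k-1} g_i(z_(i+1)) *)
Definition hbar p k (f : nat -> 'cV[R]_p -> 'cV[R]_p) (zz : 'I_k -> 'cV[R]_p)
  (k_gt0 : (0 < k)%N) : 'cV[R]_p :=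
  f 0%N (zz (Ordinal k_gt0)) - \sum_(i < k | (1 <= i)%N) gfun k f i (zz i).

Definition chi p k r q (f : nat -> 'cV[R]_p -> 'cV[R]_p) (alpha_perp : 'M[R]_(p, q))
  (theta : 'cV[R]_p -> 'cV[R]_r) (z : 'cV[R]_p) : 'cV[R]_(q + r) :=
  col_mx (alpha_perp^T *m hfun k f z) (theta z).

(* We take tau = 0 (the model is time invariant).  hist n i = z_{n-1-i},
   i = 0..k-1; hist 0 = zz, i.e. z_{-i} = z_(i).  The new value is
   z_n = f_0^{-1}(c + sum_{i=1}^k f_i(z_{n-i}) + u_n), u_0 = u, u_n = 0 (n>=1). *)

Definition shift_ord k (i : 'I_k) : 'I_k :=
  Ordinal (leq_ltn_trans (leq_pred i) (ltn_ord i)).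

Definition next_val p k (c : 'cV[R]_p) (f : nat -> 'cV[R]_p -> 'cV[R]_p)
  (f0inv : 'cV[R]_p -> 'cV[R]_p) (u : 'cV[R]_p) (n : nat) (s : 'I_k -> 'cV[R]_p)
  : 'cV[R]_p :=
  f0inv (c + \sum_(i < k) f i.+1 (s i) + (if n == 0%N then u else 0)).

Fixpoint hist p k (c : 'cV[R]_p) (f : nat -> 'cV[R]_p -> 'cV[R]_p)
  (f0inv : 'cV[R]_p -> 'cV[R]_p) (u : 'cV[R]_p) (zz : 'I_k -> 'cV[R]_p) (n : nat)
  : 'I_k -> 'cV[R]_p :=
  match n with
  | 0 => zz
  | n'.+1 => let s := hist c f f0inv u zz n' in
             fun i => if (i == 0 :> nat) then next_val c f f0inv u n' s
                      else s (shift_ord i)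
  end.

Definition traj p k (c : 'cV[R]_p) (f : nat -> 'cV[R]_p -> 'cV[R]_p)
  (f0inv : 'cV[R]_p -> 'cV[R]_p) (u : 'cV[R]_p) (zz : 'I_k -> 'cV[R]_p) (t : nat)
  : 'cV[R]_p :=
  next_val c f f0inv u t (hist c f f0inv u zz t).

Definition stable_set p k (c : 'cV[R]_p) (f : nat -> 'cV[R]_p -> 'cV[R]_p)
  (f0inv : 'cV[R]_p -> 'cV[R]_p) (S : set 'cV[R]_p) : Prop :=
  forall (u : 'cV[R]_p) (zz : 'I_k -> 'cV[R]_p),
    exists2 zinf, S zinf & traj c f f0inv u zz @ \oo --> zinf.

Definition nontrivial_attractor p k (c : 'cV[R]_p) (f : nat -> 'cV[R]_p -> 'cV[R]_p)
  (f0inv : 'cV[R]_p -> 'cV[R]_p) (zinf : 'cV[R]_p) : Prop :=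
  forall zz : 'I_k -> 'cV[R]_p, exists U : set 'cV[R]_p,
    U !=set0 /\ forall u, U u -> traj c f f0inv u zz @ \oo --> zinf.

Definition domain_of_attraction p k (c : 'cV[R]_p) (f : nat -> 'cV[R]_p -> 'cV[R]_p)
  (f0inv : 'cV[R]_p -> 'cV[R]_p) (zinf : 'cV[R]_p) (zz : 'I_k -> 'cV[R]_p)
  : set 'cV[R]_p :=
  [set u | traj c f f0inv u zz @ \oo --> zinf].

Definition strictly_stable p k (c : 'cV[R]_p) (f : nat -> 'cV[R]_p -> 'cV[R]_p)
  (f0inv : 'cV[R]_p -> 'cV[R]_p) (S : set 'cV[R]_p) : Prop :=
  stable_set k c f f0inv S /\
  forall z, S z -> nontrivial_attractor k c f f0inv z.

End NVAR.

(* Main.v *)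
Require Import Defs.
From HB Require Import structures.
From mathcomp Require Import all_boot all_order all_algebra.
From mathcomp Require Import all_classical all_reals all_analysis.
From mathcomp Require complex.
From mathcomp Require Import ring lra zify.
Import Order.TTheory GRing.Theory Num.Theory.
Import numFieldNormedType.Exports.
Import complex.ComplexEqChoice complex.ComplexField.
Set Implicit Arguments. Unset Strict Implicit. Unset Printing Implicit Defensive.
Local Open Scope classical_set_scope.
Local Open Scope ring_scope.

(** In companion form x_(t+1) = x_t + balpha w_t with w_t = F(x_t), where F has
increments beta^T (x - x') with beta in B; hence w_(t+1) = (1 + beta^T balpha) w_t.
Once products of the matrices 1 + beta^T balpha decay geometrically, x_t converges to
a zero of F, and the limit is singled out by the conserved quantity
alpha_perp^T (f_0(z_t) - sum_j g_j(z_(t-j))).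

Since the joint spectral radius is defined through spectral radii, the geometric
decay is the Berger-Wang theorem, proved by induction on the dimension. Normalise by
the exponential growth rate r of the products and suppose r >= 1. The vectors with
bounded orbit form an invariant subspace V. If V = 0, then by compactness every
vector can be doubled by a product of bounded length, so products grow faster than r.
If V is everything, a long product that is not small nearly fixes some vector by the
pigeonhole principle, so det (1 - P) is small for a subproduct P, contradicting
|det (1 - P)| >= (1 - rho)^n. Otherwise the matrices are simultaneously block
triangular and the diagonal blocks decay by induction. *)

(** * Matrix norms, eigenvalues and compactness *)

Section MatrixNorm.
Variable R : realType.

Lemma norm_mx_entry m n (A : 'M[R]_(m, n)) i j : `|A i j| <= `|A|.
Proof.
rewrite [leRHS]/Num.norm /= mx_normrE.
exact: (le_bigmax _ (fun ij : 'I_m * 'I_n => `|A ij.1 ij.2|) (i, j)).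
Qed.

Lemma norm_mx_le m n (A : 'M[R]_(m, n)) b :
  0 <= b -> (forall i j, `|A i j| <= b) -> `|A| <= b.
Proof.
move=> b0 Ab; rewrite [leLHS]/Num.norm /= mx_normrE.
by apply/bigmax_leP; split => // -[i j] _; exact: Ab.
Qed.

Lemma norm_mulmx m n p (A : 'M[R]_(m, n)) (B : 'M[R]_(n, p)) :
  `|A *m B| <= n%:R * `|A| * `|B|.
Proof.
apply: norm_mx_le => [|i j]; first by rewrite !mulr_ge0.
rewrite mxE; apply: le_trans (ler_norm_sum _ _ _) _.
rewrite -mulrA mulr_natl -[X in _ *+ X]card_ord -sumr_const.
apply: ler_sum => l _; rewrite normrM.
by apply: ler_pM => //; exact: norm_mx_entry.
Qed.

Lemma norm_row m n (A : 'M[R]_(m, n)) i : `|row i A| <= `|A|.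
Proof. by apply: norm_mx_le => // j l; rewrite mxE norm_mx_entry. Qed.

Lemma norm_det n (A : 'M[R]_n) b : `|A| <= b -> `|\det A| <= n`!%:R * b ^+ n.
Proof.
move=> Ab; rewrite /determinant; apply: le_trans (ler_norm_sum _ _ _) _.
rewrite -perm.card_Sn mulr_natl -sumr_const; apply: ler_sum => s _.
rewrite normrM normrX normrN1 expr1n mul1r normr_prod.
rewrite -[X in _ ^+ X]card_ord -prodr_const; apply: ler_prod => i _.
by rewrite normr_ge0 (le_trans (norm_mx_entry _ _ _)).
Qed.

Lemma norm_adj n b : exists K, forall A : 'M[R]_n, `|A| <= b -> `|\adj A| <= K.
Proof.
exists (n.-1`!%:R * `|b| ^+ n.-1) => A Ab.
have b0 : 0 <= b by exact: le_trans Ab.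
apply: norm_mx_le => [|i j]; first by rewrite mulr_ge0// exprn_ge0.
rewrite mxE /cofactor normrM normrX normrN1 expr1n mul1r.
apply: norm_det; rewrite ger0_norm//.
by apply: norm_mx_le => // u v; rewrite !mxE (le_trans (norm_mx_entry _ _ _)).
Qed.

End MatrixNorm.

Section SpectralBound.
Import complex.
Variable R : realType.
Implicit Types (n : nat) (rho : R).

Definition eigenvalues_le n rho (P : 'M[R]_n) :=
  forall l, complex_eigenvalues P l -> cmod l <= rho.

Lemma char_poly_horner n (P : 'M[R]_n) y : (char_poly P).[y] = \det (y%:M - P).
Proof.
rewrite /char_poly -horner_evalE -det_map_mx; congr (\det _).
by apply/matrixP => i j; rewrite !mxE /= !horner_evalE !hornerE hornerMn hornerX.
Qed.

(** Over the complex numbers the determinant is the product of the [y - z] over the [n] eigenvalues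
    with multiplicity, and each factor has modulus at least [y - rho]. *)
Lemma det_eigenvalues_le n rho (P : 'M[R]_n) y :
  eigenvalues_le rho P -> rho <= y -> 0 <= y -> (y - rho) ^+ n <= `|\det (y%:M - P)|.
Proof.
move=> Prho rhoy y0; pose C : numClosedFieldType := complex.complex R.
pose i : {rmorphism R -> C} := complex.real_complex R.
have [zs Ezs] := @closed_field_poly_normal C (map_poly i (char_poly P)).
have /monicP lc1 : map_poly i (char_poly P) \is monic.
  by rewrite map_monic char_poly_monic.
rewrite lc1 scale1r in Ezs.
have szs : size zs = n.
  by apply/succn_inj; rewrite -(size_prod_XsubC zs (fun z => z)) -Ezs size_map_poly size_char_poly.
have zs_le z : z \in zs -> `|z| <= i rho.
  rewrite -root_prod_XsubC -Ezs => /Prho zrho.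
  by rewrite complex.normc_def complex.lecR.
have : `|i (\det (y%:M - P))| = \prod_(z <- zs) `|i y - z|.
  rewrite -char_poly_horner -horner_map /= Ezs horner_prod normr_prod.
  by under eq_bigr do rewrite hornerXsubC.
move=> Edet.
have normi x : `|i x| = i `|x| by rewrite normc_def /= expr0n addr0 sqrtr_sqr.
rewrite -lecR -[X in _ <= X]normi Edet rmorphXn rmorphB -szs /=.
rewrite -[X in _ ^+ X]card_ord -prodr_const (big_nth 0) big_mkord.
apply: ler_prod => z _; apply/andP; split; first by rewrite -rmorphB lecR subr_ge0.
have := lerB_dist (i y) zs`_z; rewrite normi ger0_norm//; apply: le_trans.
by rewrite lerD2l lerN2 zs_le// mem_nth.

Qed.




(** Pulling [a] out of the matrix leads to the previous bound at [a^-1 >= 1], and [a * (a^-1 - rho)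
    = 1 - a * rho >= 1 - rho]. *)
Lemma det_sub_scale n rho (P : 'M[R]_n) a :
  eigenvalues_le rho P -> 0 <= rho <= 1 -> 0 < a <= 1 ->
  (1 - rho) ^+ n <= `|\det (1%:M - a *: P)|.
Proof.
move=> Prho /andP[rho0 rho1] /andP[a0 a1].
have ai1 : 1 <= a^-1 by rewrite invf_ge1.
have -> : 1%:M - a *: P = a *: (a^-1%:M - P).
  by rewrite scalerBr scale_scalar_mx divff// gt_eqF.
rewrite detZ normrM normrX (gtr0_norm a0).
apply: (@le_trans _ _ (a ^+ n * (a^-1 - rho) ^+ n)).
  rewrite -exprMn mulrBr divff ?gt_eqF//.
  apply: lerXn2r; rewrite ?nnegrE ?subr_ge0//; last by rewrite lerD2l lerN2 ler_piMl.
  by rewrite (le_trans _ rho1)// ler_piMl.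
apply: ler_wpM2l; first by rewrite exprn_ge0// ltW.
by apply: det_eigenvalues_le => //; lra.
Qed.

(** With [Y = 1 - a *: P], the identity [x *m Y *m \adj Y = \det Y *: x] bounds [x *m Y] from below:
    [\det Y] stays away from 0 and the adjugate is bounded. Hence one [e] serves all [P], [a] and
    [x]. *)
Lemma approx_fixed_vector n rho K c : 0 <= rho < 1 -> 0 < c ->
  exists2 e, 0 < e & forall (P : 'M[R]_n) a (x : 'rV[R]_n),
    eigenvalues_le rho P -> 0 < a <= 1 -> `|a *: P| <= K -> c <= `|x| ->
    e < `|x - x *m (a *: P)|.
Proof.
move=> /andP[rho0 rho1] c0.
have [K' HK'] := norm_adj n (`|1%:M : 'M[R]_n| + K).
pose d := (1 - rho) ^+ n * c.
have d0 : 0 < d by rewrite mulr_gt0// exprn_gt0// subr_gt0.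
have q0 : 0 < n%:R * `|K'| + 1 :> R by rewrite ltr_wpDl// mulr_ge0.
exists (d / (n%:R * `|K'| + 1)) => [|P a x Prho a01 aPK cx]; first by rewrite divr_gt0.
rewrite ltNge; apply/negP => xe.
pose Y := 1%:M - a *: P.
have {}xe : `|x *m Y| <= d / (n%:R * `|K'| + 1) by rewrite /Y mulmxBr mulmx1.
have YK : `|\adj Y| <= K'.
  by apply: HK'; rewrite (le_trans (ler_normB _ _))// lerD2l.
have : d <= `|x *m Y *m \adj Y|.
  rewrite -mulmxA mul_mx_adj mul_mx_scalar mx_normZ.
  by apply: ler_pM => //; [rewrite exprn_ge0// subr_ge0 ltW
    | apply: ltW | apply: det_sub_scale => //; rewrite rho0 ltW].
apply/negP; rewrite -ltNge; apply: le_lt_trans (norm_mulmx _ _) _.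
apply: (@le_lt_trans _ _ (n%:R * `|K'| * (d / (n%:R * `|K'| + 1)))).
  rewrite -mulrA [X in _ * X]mulrC mulrA; apply: ler_pM => //.
  by rewrite ler_wpM2l// (le_trans YK)// ler_norm.
by rewrite mulrCA gtr_pMr// ltr_pdivrMr// mul1r ltrDl.
Qed.

End SpectralBound.

Section Compactness.
Variable R : realType.

Lemma mulmx_continuous m n p (A : 'M[R]_(m, n)) :
  continuous (fun x : 'M[R]_(n, p) => A *m x).
Proof.
move=> x; apply/(@cvgrPdist_le R 'M[R]_(m, p) 'M[R]_(n, p) (nbhs x)) => e e0.
have q0 : 0 < n%:R * `|A| + 1 by rewrite ltr_wpDl// mulr_ge0.
near=> y; rewrite -mulmxBr (le_trans (norm_mulmx _ _))//.
apply: (@le_trans _ _ ((n%:R * `|A| + 1) * `|x - y|)).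
  by rewrite ler_wpM2r// lerDl.
rewrite mulrC -ler_pdivlMr//; near: y.
by apply: cvgr_dist_le => //; rewrite divr_gt0.
Unshelve. all: by end_near. Qed.

Lemma mulmxr_continuous m n p (A : 'M[R]_(n, p)) :
  continuous (fun x : 'M[R]_(m, n) => x *m A).
Proof.
move=> x; apply/(@cvgrPdist_le R 'M[R]_(m, p) 'M[R]_(m, n) (nbhs x)) => e e0.
have q0 : 0 < n%:R * `|A| + 1 by rewrite ltr_wpDl// mulr_ge0.
near=> y; rewrite -mulmxBl (le_trans (norm_mulmx _ _))//.
apply: (@le_trans _ _ ((n%:R * `|A| + 1) * `|x - y|)).
  by rewrite mulrAC ler_wpM2r// lerDl.
rewrite mulrC -ler_pdivlMr//; near: y.
by apply: cvgr_dist_le => //; rewrite divr_gt0.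
Unshelve. all: by end_near. Qed.

Lemma compact_norm_preimage n (D : set R) K :
  closed D -> (forall y, D y -> y <= K) -> compact [set x : 'rV[R]_n | D `|x|].
Proof.
move=> Dcl DK; apply: bounded_closed_compact.
  by exists K; split; [exact: num_real | move=> b Kb x /DK/le_trans; apply; exact: ltW].
by apply: (@closed_comp _ _ (@Num.norm _ 'rV[R]_n) D) => // x _; exact: norm_continuous.
Qed.

(** Here [m] is the number of balls of radius [e / 2] in a finite cover of the ball of radius [K],
    so it does not depend on the sequence. *)
Lemma bounded_pigeonhole n K e : 0 < e -> exists m, forall x : nat -> 'rV[R]_n,
  (forall i, `|x i| <= K) -> exists i j, [/\ (i < j <= m)%N & `|x i - x j| <= e].
Proof.
move=> e0; have := @compact_norm_preimage n _ K (@closed_le R K) (fun _ h => h).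
rewrite compact_cover => /(_ _ setT (fun x => ball x (e / 2))) [].
- by move=> x _; exact: ball_open.
- by move=> x _; exists x => //; apply: ballxx; rewrite divr_gt0.
move=> D _ Dcov; exists (size (finmap.enum_fset D)) => x xK.
have /choice[y yP] i : exists y, y \in finmap.enum_fset D /\ ball y (e / 2) (x i).
  by have [y yD yx] := Dcov _ (xK i); exists y.
have : ~~ uniq [seq y i | i <- iota 0 (size (finmap.enum_fset D)).+1].
  have sub : {subset [seq y i | i <- iota 0 (size (finmap.enum_fset D)).+1]
      <= finmap.enum_fset D}.
    by move=> _ /mapP[i _ ->]; have [] := yP i.
  by apply/negP => /uniq_leq_size/(_ sub); rewrite size_map size_iota ltnn.
move=> /(uniqPn 0)[i [j [ij]]]; rewrite size_map size_iota => jD.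
rewrite !(nth_map 0%N) ?size_iota// ?(ltn_trans ij)// !nth_iota ?(ltn_trans ij)// !add0n.
move=> yij; exists i, j; split; first by rewrite ij.
rewrite [e]splitr; apply: le_trans (ler_distD (y i) _ _) _.
have [_ xi] := yP i; have [_ xj] := yP j; rewrite -{}yij in xj.
move: xi xj; rewrite -ball_normE /= => xi xj.
by rewrite lerD// ltW// distrC.
Qed.

End Compactness.

(** * The Berger-Wang theorem *)

Section RealSequences.
Variable R : realType.
Implicit Types h q : R.

Lemma bernoulli_subr h m : 0 <= h <= 1 -> 1 - m%:R * h <= (1 - h) ^+ m.
Proof.
move=> /andP[h0 h1]; elim: m => [|m IH]; first by rewrite mul0r subr0 expr0.
rewrite exprS; apply: (@le_trans _ _ ((1 - h) * (1 - m%:R * h))); last first.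
  by rewrite ler_wpM2l// subr_ge0.
have : 0 <= m%:R * h ^+ 2 by rewrite mulr_ge0// exprn_ge0.
by rewrite -natr1; nra.
Qed.

(** The sum [1 + q + ... + q ^+ (m - 1)] has [m] terms, each at least [q ^+ m]. This later absorbs a
    factor linear in the word length. *)
Lemma natr_mul_expr_le q m : 0 <= q <= 1 -> m%:R * q ^+ m * (1 - q) <= 1 - q ^+ m.
Proof.
move=> /andP[q0 q1]; elim: m => [|m IH]; first by rewrite !mul0r expr0 subrr.
have qm : 0 <= q ^+ m <= 1 by rewrite exprn_ge0// exprn_ile1.
have h1 := ler_wpM2l q0 IH.
have h2 : 0 <= (1 - q) * (1 - q * q ^+ m).
  by rewrite mulr_ge0 ?subr_ge0// mulr_ile1//; case/andP: qm.
rewrite -natr1 exprS; move: h1 h2; set u := q ^+ m; set t := m%:R; lra.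
Qed.

End RealSequences.

Section Products.
Variable R : realType.
Implicit Types (n : nat) (a g : R).

Definition words n (A : set 'M[R]_n) : set (seq 'M[R]_n) :=
  [set s : seq 'M[R]_n | forall M, M \in s -> A M].

Definition mxprods n (s : seq 'M[R]_n) : 'M[R]_n := \big[mulmx/1%:M]_(M <- s) M.

(** In use [a] is the inverse of the growth rate, so these are the normalised products. *)
Definition wprod n a (s : seq 'M[R]_n) : 'M[R]_n := a ^+ size s *: mxprods s.

Definition growth_le n (A : set 'M[R]_n) g :=
  exists C, forall s, words A s -> `|mxprods s| <= C * g ^+ size s.

Definition exp_stable n (A : set 'M[R]_n) :=
  exists2 g, 0 < g < 1 & growth_le A g.

Definition eventually_contracting n (A : set 'M[R]_n) rho N :=
  forall s, words A s -> (N <= size s)%N -> eigenvalues_le rho (mxprods s).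

Lemma mxprods_nil n : mxprods [::] = 1%:M :> 'M[R]_n.
Proof. exact: big_nil. Qed.

Lemma mxprods_cons n M (s : seq 'M[R]_n) : mxprods (M :: s) = M *m mxprods s.
Proof. exact: big_cons. Qed.

Lemma mxprods_cat n (s t : seq 'M[R]_n) : mxprods (s ++ t) = mxprods s *m mxprods t.
Proof.
elim: s => [|M s IH]; first by rewrite mxprods_nil mul1mx.
by rewrite cat_cons !mxprods_cons IH mulmxA.
Qed.

Lemma wprod_nil n a : wprod a [::] = 1%:M :> 'M[R]_n.
Proof. by rewrite /wprod expr0 scale1r mxprods_nil. Qed.

Lemma wprod_cat n a (s t : seq 'M[R]_n) : wprod a (s ++ t) = wprod a s *m wprod a t.
Proof.
by rewrite /wprod mxprods_cat size_cat exprD -scalemxAl -scalemxAr scalerA.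
Qed.

Lemma norm_wprod n a (s : seq 'M[R]_n) : 0 <= a ->
  `|wprod a s| = a ^+ size s * `|mxprods s|.
Proof. by move=> a0; rewrite mx_normZ ger0_norm// exprn_ge0. Qed.

Lemma words_nil n (A : set 'M[R]_n) : words A [::].
Proof. by []. Qed.

Lemma words_cons n (A : set 'M[R]_n) M s : words A (M :: s) <-> A M /\ words A s.
Proof.
split=> [As|[AM As] P]; last by rewrite inE => /orP[/eqP->|/As].
split=> [|P Ps]; apply: As; first exact: mem_head.
by rewrite inE Ps orbT.
Qed.

Lemma words_cat n (A : set 'M[R]_n) s t : words A (s ++ t) <-> words A s /\ words A t.
Proof.
split=> [As|[As At] M]; last by rewrite mem_cat => /orP[/As|/At].
by split=> M Ms; apply: As; rewrite mem_cat Ms ?orbT.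
Qed.

Lemma words_take n (A : set 'M[R]_n) m s : words A s -> words A (take m s).
Proof. by move=> As M /mem_take/As. Qed.

Lemma words_drop n (A : set 'M[R]_n) m s : words A s -> words A (drop m s).
Proof. by move=> As M /mem_drop/As. Qed.

Lemma growth_le_ge0 n (A : set 'M[R]_n) C g :
  (forall s, words A s -> `|mxprods s| <= C * g ^+ size s) -> 0 <= C.
Proof.
by move=> /(_ _ (words_nil A)); rewrite expr0 mulr1; apply: le_trans.
Qed.

(** The factor [n] is the loss in [norm_mulmx] for the maximum norm; the added 1 makes the rate
    positive. *)
Lemma growth_le_bounded n (A : set 'M[R]_n) b :
  (forall M, A M -> `|M| <= b) -> 0 <= b -> growth_le A (n%:R * b + 1).
Proof.
move=> Ab b0; exists `|1%:M : 'M[R]_n|; elim=> [|M s IH].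
  by rewrite mxprods_nil expr0 mulr1.
move=> /words_cons[/Ab Mb /IH {}IH]; rewrite mxprods_cons /= exprS.
apply: le_trans (norm_mulmx _ _) _; rewrite mulrCA.
apply: ler_pM => //; rewrite ?mulr_ge0//.
by rewrite (le_trans (ler_wpM2l _ Mb))// lerDl.
Qed.

(** A word that more than doubles a unit vector does so on a neighbourhood. By compactness of the
    unit sphere finitely many words suffice, and [L] is their maximal length. *)
Lemma doubling n (A : set 'M[R]_n) a :
  (forall x : 'rV[R]_n, x != 0 -> forall K,
     exists2 s, words A s & K < `|x *m wprod a s|) ->
  exists L, forall x : 'rV[R]_n,
    exists s, [/\ words A s, (size s <= L)%N & 2 * `|x| <= `|x *m wprod a s|].
Proof.
move=> unb.
have cS : compact [set x : 'rV[R]_n | `|x| = 1].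
  apply: (@compact_norm_preimage R n [set y | y = 1] 1); last by move=> y ->.
  exact: closed_eq.
rewrite compact_cover in cS.
have [||D DA cov] := cS _ (words A) (fun s => [set x : 'rV[R]_n | 2 < `|x *m wprod a s|]).
- move=> s _; apply: (@open_comp _ _ (fun x : 'rV[R]_n => `|x *m wprod a s|) [set y | 2 < y]).
    move=> x _; apply: (@continuous_comp _ _ _ (fun x : 'rV[R]_n => x *m wprod a s)).
      exact: mulmxr_continuous.
    exact: norm_continuous.
  exact: open_gt.
- move=> x /= x1; have x0 : x != 0 by rewrite -normr_eq0 x1 oner_neq0.
  by have [s As sx] := unb x x0 2; exists s.
exists (\max_(s <- finmap.enum_fset D) size s) => x.
have [->|x0] := eqVneq x 0.
  by exists [::]; split => //; rewrite normr0 mulr0.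
have nx : 0 < `|x| by rewrite normr_gt0.
have [|s Ds /= xs] := cov (`|x|^-1 *: x).
  by rewrite /= mx_normZ normfV normr_id mulVf// gt_eqF.
exists s; split; first by have := DA _ Ds; rewrite inE.
  by apply: (@leq_bigmax_seq _ (finmap.enum_fset D) xpredT (fun t => size t)); first exact: Ds.
rewrite -scalemxAl mx_normZ normfV normr_id mulrC in xs.
by rewrite -ler_pdivlMr// ltW.
Qed.

(** Iterated doubling makes the normalised products grow exponentially in the word length, whereas
    the hypothesis allows only subexponential growth. *)
Lemma not_doubling n (A : set 'M[R]_n) a L : (0 < n)%N ->
  (forall b, 0 < b < 1 ->
     exists C, forall s, words A s -> b ^+ size s * `|wprod a s| <= C) ->
  ~ forall x : 'rV[R]_n,
    exists s, [/\ words A s, (size s <= L)%N & 2 * `|x| <= `|x *m wprod a s|].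
Proof.
case: n A => [//|n] A _ sub dbl.
(* By Bernoulli's inequality [(1 - h) ^+ L >= 3 / 4], so discounting by [1 - h] per letter leaves a
   factor [2 * (3 / 4) = 3 / 2] per doubling. *)
pose h : R := (4 * L.+1%:R)^-1.
have h0 : 0 < h by rewrite invr_gt0 mulr_gt0.
have hL : L%:R * h <= 4^-1.
  by rewrite /h invfM mulrCA ler_piMr// ler_pdivrMr// mul1r ler_nat.
have h1 : h <= 4^-1.
  by rewrite /h invfM ler_piMr// invf_le1// ler1n.
have [|C HC] := sub (1 - h); first by lra.
have bL : 3 / 4 <= (1 - h) ^+ L.
  by apply: le_trans (bernoulli_subr _ _); lra.
pose x : 'rV[R]_n.+1 := const_mx 1.
have x1 : 1 <= `|x|.
  by apply: le_trans (norm_mx_entry x 0 0); rewrite mxE normr1.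
have grow j : exists2 s, words A s & (3 / 2) ^+ j <= (1 - h) ^+ size s * `|x *m wprod a s|.
  elim: j => [|j [s As Hs]].
    by exists [::] => //; rewrite !expr0 mul1r wprod_nil mulmx1.
  have [t [At tL Ht]] := dbl (x *m wprod a s).
  exists (s ++ t); first by apply/words_cat.
  rewrite wprod_cat mulmxA size_cat exprD.
  have tb : 3 / 4 <= (1 - h) ^+ size t.
    by apply: (le_trans bL); apply: ler_wiXn2l => //; lra.
  have p0 : 0 <= (1 - h) ^+ size s by rewrite exprn_ge0//; lra.
  set u := _ ^+ size s in p0 Hs *; set v := _ ^+ size t in tb *.
  set y := `|x *m _| in Hs Ht; have y0 : 0 <= y by exact: normr_ge0.
  set z := `|_ *m wprod a t| in Ht *.
  rewrite exprS; set w := _ ^+ j in Hs *.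
  have uy : 0 <= u * y by rewrite mulr_ge0.
  apply: (@le_trans _ _ (u * (3 / 4) * (2 * y))); first by lra.
  by apply: ler_pM => //; rewrite ?ler_wpM2l// ?mulr_ge0.
have C0 : 0 <= C.
  by have := HC _ (words_nil A); apply: le_trans; rewrite expr0 mul1r.
have bnd j : (3 / 2 : R) ^+ j <= n.+1%:R * `|x| * C.
  have [s As /le_trans] := grow j; apply.
  apply: (@le_trans _ _ (n.+1%:R * `|x| * ((1 - h) ^+ size s * `|wprod a s|))).
    rewrite mulrCA ler_wpM2l//; last exact: norm_mulmx.
    by rewrite exprn_ge0//; lra.
  by rewrite ler_wpM2l// ?mulr_ge0// HC.
pose B := n.+1%:R * `|x| * C.
have lin j : 1 + j%:R / 2 <= (3 / 2 : R) ^+ j.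
  elim: j => [|j IH]; first by rewrite expr0 mul0r addr0.
  have j0 : 0 <= j%:R :> R by [].
  by rewrite exprS -natr1; nra.
have B0 : 0 <= B by rewrite !mulr_ge0.
have := archi_boundP (_ : 0 <= 2 * B); rewrite mulr_ge0// => /(_ isT).
set m := Num.bound _ => Bm; have := le_trans (lin m) (bnd m); rewrite -/B; lra.
Qed.

(** Each block of length [T] cut off a word costs a factor [2^-1 <= g ^+ T], the [n%:R] making up
    for the loss in [norm_mulmx]. The remainder, shorter than [T], accounts for the constant
    [2 * K]. *)
Lemma exp_decay_of_blocks n (A : set 'M[R]_n) a K T : (0 < T)%N ->
  (forall s, words A s -> `|wprod a s| <= K) ->
  (forall s, words A s -> size s = T -> n%:R * `|wprod a s| <= 2^-1) ->
  exists C g, 0 < g < 1 /\ forall s, words A s -> `|wprod a s| <= C * g ^+ size s.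
Proof.
move=> T0 AK AT; pose h : R := (2 * T%:R)^-1; pose g := 1 - h.
have T1 : 1 <= T%:R :> R by rewrite ler1n.
have h0 : 0 < h by rewrite invr_gt0 mulr_gt0// ltr0n.
have h1 : h <= 2^-1 by rewrite /h invfM ler_piMr// invf_le1// ltr0n.
have g01 : 0 < g < 1 by rewrite /g; lra.
have gT : 2^-1 <= g ^+ T.
  apply: le_trans (bernoulli_subr _ _); last by lra.
  by rewrite /h invfM mulrCA divff ?pnatr_eq0 -?lt0n//; lra.
exists (2 * K), g; split => // s.
have K0 : 0 <= K by have := AK _ (words_nil A); apply: le_trans.
have [m] := ubnP (size s); elim: m s => // m IH s sm As.
have [sT|Ts] := ltnP (size s) T.
  apply: le_trans (AK _ As) _; rewrite mulrAC ler_peMl//.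
  have : g ^+ T <= g ^+ size s by apply: ler_wiXn2l; [lra|lra|exact: ltnW].
  lra.
rewrite -(cat_take_drop T s) wprod_cat size_cat size_takel// exprD.
apply: le_trans (norm_mulmx _ _) _.
have dr : `|wprod a (drop T s)| <= 2 * K * g ^+ size (drop T s).
  apply: IH; last exact: words_drop.
  rewrite size_drop; lia.
rewrite mulrCA; apply: ler_pM => //.
apply: le_trans gT; apply: AT; first exact: words_take.
by rewrite size_takel.
Qed.

End Products.

Section BoundedCase.
Variable R : realType.
Implicit Types (n : nat) (a g : R).

(** If a product of length [T] has a large entry in row [i], then row [i] of each prefix product is
    bounded below as well as above. Two of these rows are close, so the factor between the two
    prefixes nearly fixes a vector, against [approx_fixed_vector]. *)
Lemma exp_decay_of_bounded n (A : set 'M[R]_n) a rho N K : 0 < a <= 1 -> 0 <= rho < 1 ->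
  eventually_contracting A rho N -> (forall s, words A s -> `|wprod a s| <= K) ->
  exists C g, 0 < g < 1 /\ forall s, words A s -> `|wprod a s| <= C * g ^+ size s.
Proof.
move=> a01 rho01 Arho AK0.
pose q : R := n.+1%:R; have q1 : 1 <= q by rewrite ler1n.
wlog K1 : K AK0 / 1 <= K.
  move=> /(_ (Num.max 1 K)); apply; last by rewrite le_max lexx.
  by move=> s As; rewrite le_max AK0// orbT.
(* Passing from a prefix row to the full row multiplies the norm by at most [q * K], so an entry
   above [(2 * q)^-1] forces every prefix row to have norm at least [c]. *)
pose c := (2 * q)^-1 / (q * K).
have c0 : 0 < c by rewrite divr_gt0 ?invr_gt0 ?mulr_gt0//; lra.
have [e e0 He] := approx_fixed_vector n K rho01 c0.
have [m Hm] := bounded_pigeonhole n K e0.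
(* Room for the [m + 1] prefixes of lengths [0, N.+1, ..., m * N.+1]; the spacing makes each factor
   between two of them longer than [N]. *)
pose T := (m * N.+1).+1.
apply: (@exp_decay_of_blocks _ n A a K T) => // s As sT.
rewrite leNgt; apply/negP => big.
have [i [j wij]] : exists i j, (2 * q)^-1 < `|wprod a s i j|.
  apply/not_existsP => noi; move: big; apply/negP; rewrite -leNgt.
  apply: (@le_trans _ _ (n%:R * (2 * q)^-1)).
    rewrite ler_wpM2l//; apply: norm_mx_le => [|i j].
      by rewrite invr_ge0 mulr_ge0//; lra.
    by rewrite leNgt; apply/negP => wij; apply: (noi i); exists j.
  by rewrite invfM mulrCA ler_piMr// ler_pdivrMr ?mul1r /q ?ler_nat//; lra.
pose x k := row i (wprod a (take (k * N.+1) s)).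
have xK k : `|x k| <= K.
  by rewrite (le_trans (norm_row _ _))// AK0//; exact: words_take.
have xc k : c <= `|x k|.
  rewrite /c ler_pdivrMr; last by rewrite mulr_gt0//; lra.
  apply/ltW/(lt_le_trans wij).
  have -> : wprod a s i j = (x k *m wprod a (drop (k * N.+1) s)) 0 j.
    by rewrite /x -row_mul -wprod_cat cat_take_drop [RHS]mxE.
  apply: le_trans (norm_mx_entry _ _ _) _; apply: le_trans (norm_mulmx _ _) _.
  rewrite mulrA [X in _ <= X * _]mulrC; apply: ler_pM => //.
    by rewrite ler_wpM2r// /q ler_nat.
  by rewrite AK0//; exact: words_drop.
have [k [l [/andP[kl lm] xkl]]] := Hm x xK.
pose d := ((l - k) * N.+1)%N.
pose t := take d (drop (k * N.+1) s).
have td : size t = d.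
  rewrite size_takel// size_drop sT /T /d mulnBl leq_sub2r//.
  by rewrite leqW// leq_mul2r lm orbT.
have xl : x l = x k *m (a ^+ d *: mxprods t).
  rewrite /x -td -/(wprod a t) -row_mul -wprod_cat; congr (row _ (wprod _ _)).
  by rewrite -takeD -mulnDl subnKC// ltnW.
have At : words A t by apply: words_take; exact: words_drop.
move: xkl; rewrite xl; apply/negP; rewrite -ltNge.
apply: He => //.
- apply: Arho => //; rewrite td /d.
  by rewrite (leq_trans (leqnSn N))// leq_pmull// subn_gt0.
- by case/andP: a01 => a0 a1; rewrite exprn_gt0// exprn_ile1// ltW.
- by rewrite -td AK0.
Qed.

(** A matrix of maximal rank among those with row space inside [W] works: adjoining a missed vector
    would raise the rank. *)
Lemma subspace_matrix n (W : set 'rV[R]_n) :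
  W 0 -> (forall a x y, W x -> W y -> W (a *: x + y)) ->
  exists V : 'M[R]_n, forall x, W x <-> (x <= V)%MS.
Proof.
move=> W0 Wlin.
pose P r := `[< exists V : 'M[R]_n, \rank V = r /\ forall x : 'rV_n, (x <= V)%MS -> W x >].
have P0 : exists r, P r.
  by exists 0%N; apply/asboolP; exists 0; rewrite mxrank0; split => // x; rewrite submx0 => /eqP->.
have Pn r : P r -> (r <= n)%N by move=> /asboolP[V [<- _]]; exact: rank_leq_row.
case: (ex_maxnP P0 Pn) => r /asboolP[V [rV VW]] maxr; exists V => x; split; last exact: VW.
move=> Wx; apply/negPn/negP => xV.
have : (r < \rank (V + x))%N.
  rewrite -rV; apply: rank_ltmx; rewrite ltmxE addsmxSl /=.
  by apply: contra xV; apply: submx_trans; exact: addsmxSr.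
rewrite ltnNge maxr//; apply/asboolP; exists (V + x)%MS; split => // y.
move=> /sub_addsmxP[[u v] /= ->]; rewrite addrC.
have -> : v *m x = v 0 0 *: x by rewrite {1}[v]mx11_scalar mul_scalar_mx.
by apply: Wlin => //; apply: VW; exact: submxMl.
Qed.

End BoundedCase.

(** * Simultaneously block triangular families *)

Section Blocks.
Variable R : realType.
Implicit Types (n : nat) (a g : R).

Lemma char_poly_conj n (G M : 'M[R]_n) : G \in unitmx ->
  char_poly (G *m M *m invmx G) = char_poly M.
Proof.
move=> Gu; pose F := map_mx (@polyC R) G; pose F' := map_mx (@polyC R) (invmx G).
have FF' : F *m F' = 1%:M by rewrite -map_mxM mulmxV// map_mx1.
rewrite /char_poly.
have -> : char_poly_mx (G *m M *m invmx G) = F *m char_poly_mx M *m F'.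
  rewrite /char_poly_mx !map_mxM /= mulmxBr mulmxBl -/F -/F'; congr (_ - _).
  by rewrite mul_mx_scalar -scalemxAl FF' scalemx1.
rewrite !det_mulmx mulrAC -det_mulmx FF' det1 mul1r//.
Qed.

Lemma char_poly_lower_block n1 n2 (M : 'M[R]_(n1 + n2)) : ursubmx M = 0 ->
  char_poly M = char_poly (ulsubmx M) * char_poly (drsubmx M).
Proof.
move=> M0; rewrite -{1}[M]submxK M0 /char_poly.
rewrite /char_poly_mx map_block_mx map_mx0 scalar_mx_block opp_block_mx add_block_mx.
by rewrite oppr0 addr0 det_lblock.
Qed.

Lemma mul_lower_block n1 n2 (M P : 'M[R]_(n1 + n2)) : ursubmx M = 0 -> ursubmx P = 0 ->
  M *m P = block_mx (ulsubmx M *m ulsubmx P) 0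
    (dlsubmx M *m ulsubmx P + drsubmx M *m dlsubmx P) (drsubmx M *m drsubmx P).
Proof.
move=> M0 P0; rewrite -{1}[M]submxK -{1}[P]submxK mulmx_block M0 P0.
by rewrite !mul0mx !mulmx0 !addr0 add0r.
Qed.

Lemma eigenvalues_le_dvd n m rho (P : 'M[R]_n) (Q : 'M[R]_m) :
  char_poly Q %| char_poly P -> eigenvalues_le rho P -> eigenvalues_le rho Q.
Proof.
move=> /dvdpP[q Eq] Prho l Ql; apply: Prho; rewrite /complex_eigenvalues /= Eq.
pose i : {rmorphism R -> complex.complex R} := complex.real_complex R.
change (is_true (root (map_poly i (q * char_poly Q)) l)).
by rewrite rmorphM rootM [X in _ || X]Ql orbT.
Qed.

(* Applied with [f] extracting a diagonal block of block triangular matrices. *)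
Lemma contracting_image n m (A Z : set 'M[R]_n) (f : 'M[R]_n -> 'M[R]_m) rho N :
  A `<=` Z -> Z 1%:M -> f 1%:M = 1%:M ->
  (forall M P, Z M -> Z P -> Z (M *m P) /\ f (M *m P) = f M *m f P) ->
  (forall P, Z P -> char_poly (f P) %| char_poly P) ->
  eventually_contracting A rho N -> eventually_contracting (f @` A) rho N.
Proof.
move=> AZ Z1 f1 fM fchar Arho t At tN.
have [s [As st Zs ->]] : exists s, [/\ words A s, size s = size t,
    Z (mxprods s) & mxprods t = f (mxprods s)].
  elim: t At {tN} => [_|M t IH /words_cons[[P AP <-] /IH[s [As st Zs ts]]]].
    by exists [::]; split; rewrite ?mxprods_nil.
  have [ZPs fPs] := fM P (mxprods s) (AZ _ AP) Zs.
  exists (P :: s); split; rewrite ?mxprods_cons//=; first exact/words_cons.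
    by rewrite st.
  by rewrite ts fPs.
by apply: eigenvalues_le_dvd (fchar _ Zs) _; apply: Arho; rewrite ?st.
Qed.

(** The lower left block of a product of length [t] is a sum over positions: lower right block of a
    prefix, corner of one factor, upper left block of the suffix. It is at most of order
    [t * g ^+ (t - 1)], and any rate above [g] absorbs the [t]. *)
Lemma exp_stable_lower_block n1 n2 (A : set 'M[R]_(n1 + n2)) b :
  (forall M, A M -> ursubmx M = 0) -> (forall M, A M -> `|M| <= b) ->
  exp_stable (ulsubmx @` A) -> exp_stable (drsubmx @` A) -> exp_stable A.
Proof.
move=> AZ Ab [g1 g101 [C1 H1]] [g2 g201 [C2 H2]].
have C10 := growth_le_ge0 H1; have C20 := growth_le_ge0 H2.
pose g := Num.max g1 g2.
have [/andP[g10 g11] /andP[g20 g21]] := (g101, g201).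
have g0 : 0 < g by rewrite lt_max g10.
have g1g : g1 <= g by rewrite le_max lexx.
have g2g : g2 <= g by rewrite le_max lexx orbT.
have g1' : g < 1 by rewrite gt_max g11.
have words_im m (f : 'M[R]_(n1 + n2) -> 'M[R]_m) s : words A s -> words (f @` A) (map f s).
  by move=> As _ /mapP[M Ms ->]; exists M => //; exact: As.
have prodE s : words A s -> [/\ ursubmx (mxprods s) = 0,
    ulsubmx (mxprods s) = mxprods (map ulsubmx s) &
    drsubmx (mxprods s) = mxprods (map drsubmx s)].
  elim: s => [_|M s IH /words_cons[AM /IH[Z1 Z2 Z3]]].
    rewrite /= !mxprods_nil; have -> : 1%:M = block_mx 1%:M 0 0 1%:M :> 'M[R]_(n1 + n2).
      by rewrite -scalar_mx_block.
    by rewrite block_mxKur block_mxKul block_mxKdr.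
  rewrite /= !mxprods_cons mul_lower_block//; last exact: AZ.
  by rewrite block_mxKur block_mxKul block_mxKdr Z2 Z3.
have bul s : words A s -> `|ulsubmx (mxprods s)| <= C1 * g ^+ size s.
  move=> As; have [_ -> _] := prodE s As.
  apply: le_trans (H1 _ (words_im _ _ _ As)) _; rewrite size_map ler_wpM2l//.
  by apply: lerXn2r; rewrite // nnegrE ltW.
have bdr s : words A s -> `|drsubmx (mxprods s)| <= C2 * g ^+ size s.
  move=> As; have [_ _ ->] := prodE s As.
  apply: le_trans (H2 _ (words_im _ _ _ As)) _; rewrite size_map ler_wpM2l//.
  by apply: lerXn2r; rewrite // nnegrE ltW.
pose D := n2%:R * C2 * (n1%:R * `|b| * C1).
have D0 : 0 <= D by rewrite !mulr_ge0.
(* Carrying the prefix [s0] through the induction builds the sum one position at a time; the factor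
   [g] on the left avoids an exponent reduced by one. *)
have bdl s : words A s -> forall s0, words A s0 ->
    g * `|drsubmx (mxprods s0) *m dlsubmx (mxprods s)|
      <= D * (size s)%:R * g ^+ (size s0 + size s).
  elim: s => [_ s0 _|M s IH /words_cons[AM As] s0 As0].
    rewrite mxprods_nil scalar_mx_block block_mxKdl mulmx0 normr0 !mulr0 mul0r//.
  have [Z1 _ _] := prodE s As.
  rewrite mxprods_cons mul_lower_block//; last exact: AZ.
  rewrite block_mxKdl mulmxDr; apply: le_trans (ler_wpM2l (ltW g0) (ler_normD _ _)) _.
  rewrite mulrDr -natr1 mulrDr mulr1 mulrDl addrC; apply: lerD.
    have AsM : words A (rcons s0 M).
      by rewrite -cats1; apply/words_cat; split => //; apply/words_cons.
    have := IH As _ AsM; rewrite size_rcons addSnnS; apply: le_trans.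
    rewrite -cats1 mxprods_cat mxprods_cons mxprods_nil mulmx1.
    have [Z0 _ _] := prodE s0 As0.
    by rewrite mul_lower_block ?block_mxKdr ?mulmxA//; exact: AZ.
  have -> : D * g ^+ (size s0 + size (M :: s)) = g * (g ^+ size s0 * (D * g ^+ size s)).
    by rewrite /= addnS exprS exprD; ring.
  apply: ler_wpM2l; first exact: ltW.
  apply: le_trans (norm_mulmx _ _) _.
  have -> : g ^+ size s0 * (D * g ^+ size s) =
      n2%:R * (C2 * g ^+ size s0) * (n1%:R * `|b| * (C1 * g ^+ size s)).
    by rewrite /D; ring.
  apply: ler_pM => //; first by rewrite ler_wpM2l// bdr.
  apply: le_trans (norm_mulmx _ _) _; apply: ler_pM => //; last exact: bul.
  rewrite ler_wpM2l//; apply: norm_mx_le => // i j.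
  by rewrite !mxE (le_trans (norm_mx_entry _ _ _))// (le_trans (Ab _ AM))// ler_norm.
(* For any [h] strictly between [g] and 1 and [q = g / h], one has
   [t * g ^+ t = t * q ^+ t * h ^+ t] with [t * q ^+ t <= (1 - q)^-1]. *)
pose h := (1 + g) / 2.
have h01 : 0 < h < 1 by rewrite /h; lra.
have [h0 h1] := andP h01.
have gh : g <= h by rewrite /h; lra.
pose q := g / h.
have q0 : 0 < q by rewrite divr_gt0.
have q1 : q < 1 by rewrite /q ltr_pdivrMr// mul1r /h; lra.
have tq t : t%:R * g ^+ t <= (1 - q)^-1 * h ^+ t.
  have gE : g = q * h by rewrite /q divfK// lt0r_neq0.
  rewrite [in X in X <= _]gE exprMn mulrA; apply: ler_wpM2r; first by rewrite exprn_ge0 ?ltW.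
  rewrite -[X in _ <= X]mul1r ler_pdivlMr ?subr_gt0//.
  apply: le_trans (natr_mul_expr_le _ _) _; first by rewrite !ltW.
  by rewrite gerBl exprn_ge0// ltW.
exists h => //; exists (C1 + C2 + g^-1 * D * (1 - q)^-1) => s As.
have E0 : 0 <= g^-1 * D * (1 - q)^-1.
  by rewrite !mulr_ge0// invr_ge0 ?subr_ge0 ltW.
have hs : g ^+ size s <= h ^+ size s by apply: lerXn2r; rewrite // nnegrE ltW.
have hs0 : 0 <= h ^+ size s by rewrite exprn_ge0// ltW.
have bdl' : `|dlsubmx (mxprods s)| <= g^-1 * D * (1 - q)^-1 * h ^+ size s.
  have := bdl s As [::] (@words_nil _ _ A).
  rewrite mxprods_nil scalar_mx_block block_mxKdr mul1mx add0n.
  rewrite mulrC -ler_pdivlMr// => /le_trans; apply.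
  have -> : D * (size s)%:R * g ^+ size s / g = g^-1 * D * ((size s)%:R * g ^+ size s).
    by ring.
  rewrite -[X in _ <= X]mulrA; apply: ler_wpM2l; last exact: tq.
  by rewrite mulr_ge0// invr_ge0 ltW.
have [Z1 _ _] := prodE s As.
rewrite -[mxprods s]submxK Z1; apply: norm_mx_le => [|i j].
  by rewrite mulr_ge0// !addr_ge0.
rewrite !mxE; case: fintype.splitP => i' _; rewrite !mxE; case: fintype.splitP => j' _.
- apply: le_trans (norm_mx_entry _ _ _) _; apply: le_trans (bul _ As) _.
  rewrite !mulrDl -addrA; apply: (@le_trans _ _ (C1 * h ^+ size s)).
    by rewrite ler_wpM2l.
  by rewrite lerDl addr_ge0// mulr_ge0.
- by rewrite mxE normr0 mulr_ge0// !addr_ge0.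
- apply: le_trans (norm_mx_entry _ _ _) _; apply: le_trans bdl' _.
  by rewrite [X in _ <= X]mulrDl lerDr mulr_ge0// addr_ge0.
- apply: le_trans (norm_mx_entry _ _ _) _; apply: le_trans (bdr _ As) _.
  apply: (@le_trans _ _ (C2 * h ^+ size s)); first by rewrite ler_wpM2l.
  by rewrite ler_wpM2r// -addrA addrCA lerDl addr_ge0.
Qed.

Lemma exp_stable_conj n (A : set 'M[R]_n) G : G \in unitmx ->
  exp_stable [set G *m M *m invmx G | M in A] -> exp_stable A.
Proof.
move=> Gu [g g01 [C HC]]; exists g => //.
have C0 := growth_le_ge0 HC.
exists (n%:R * (n%:R * `|invmx G| * C) * `|G|) => s As.
pose f M := G *m M *m invmx G.
have fs : mxprods (map f s) = f (mxprods s).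
  elim: s {As} => [|M s IH]; first by rewrite mxprods_nil /f mulmx1 mulmxV// mxprods_nil.
  by rewrite /= !mxprods_cons IH /f !mulmxA mulmxKV.
have -> : mxprods s = invmx G *m mxprods (map f s) *m G.
  by rewrite fs /f !mulmxA mulVmx// mul1mx mulmxKV.
have := HC (map f s); rewrite size_map => HCs.
rewrite mulrAC; apply: le_trans (norm_mulmx _ _) _.
apply: ler_wpM2r => //; rewrite -[X in _ <= X]mulrA; apply: ler_wpM2l => //.
apply: le_trans (norm_mulmx _ _) _; rewrite -[X in _ <= X]mulrA.
apply: ler_wpM2l; first by rewrite mulr_ge0.
by apply: HCs => _ /mapP[M Ms ->]; exists M => //; exact: As.
Qed.

(** In a basis adapted to [V] the diagonal blocks are the actions on [V] and on the quotient. Their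
    characteristic polynomials divide the full one, so the eigenvalue bound passes to them. The
    first hypothesis is the induction hypothesis of [berger_wang]. *)
Lemma exp_stable_invariant n (A : set 'M[R]_n) (V : 'M[R]_n) b rho N :
  (forall m (A' : set 'M[R]_m) b', (m < n)%N -> (forall M, A' M -> `|M| <= b') ->
     eventually_contracting A' rho N -> exp_stable A') ->
  (0 < \rank V < n)%N -> (forall M, A M -> (V *m M <= V)%MS) ->
  (forall M, A M -> `|M| <= b) -> eventually_contracting A rho N -> exp_stable A.
Proof.
move=> IH /andP[V0 Vn] AV Ab Arho.
have [n1 rV] : exists n1, \rank V = n1 by exists (\rank V).
have [n2 En] : exists n2, n = (n1 + n2)%N by exists (n - n1)%N; rewrite -rV subnKC// ltnW.
rewrite rV in V0 Vn; subst n.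
(* The first [\rank V] rows of [row_ebase V] span [V]. *)
pose G := row_ebase V; have Gu : G \in unitmx := row_ebase_unit V.
pose cj (M : 'M[R]_(n1 + n2)) := G *m M *m invmx G.
have VE : col_ebase V *m pid_mx n1 *m G = V.
  by have := mulmx_ebase V; rewrite rV.
have cjM M P : cj (M *m P) = cj M *m cj P by rewrite /cj !mulmxA mulmxKV.
have cj0 M : A M -> ursubmx (cj M) = 0.
  move=> /AV/submxP[X EX].
  have pidV : pid_mx n1 *m G = invmx (col_ebase V) *m V.
    by rewrite -[LHS](mulKmx (col_ebase_unit V)); congr (_ *m _); rewrite mulmxA VE.
  have XV : X *m V = X *m col_ebase V *m pid_mx n1 *m G.
    by rewrite -[in LHS]VE !mulmxA.
  (* This is invariance in the new basis; comparing upper right blocks gives the zero block. *)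
  have : pid_mx n1 *m cj M = invmx (col_ebase V) *m X *m col_ebase V *m pid_mx n1.
    rewrite /cj !mulmxA pidV -[X in X *m _]mulmxA EX XV.
    by rewrite !mulmxA -[LHS]mulmxA mulmxV// mulmx1.
  move: (_ *m col_ebase V) => Y.
  rewrite pid_mx_block -[cj M in LHS]submxK -[Y]submxK !mulmx_block.
  rewrite !mul1mx !mul0mx !mulmx0 !addr0 => /eq_block_mx[_ -> _ _].
  by [].
pose Ac := cj @` A.
pose bc := (n1 + n2)%:R * ((n1 + n2)%:R * `|G| * `|b|) * `|invmx G|.
have Acb M : Ac M -> `|M| <= bc.
  move=> [P /Ab Pb <-]; apply: le_trans (norm_mulmx _ _) _; apply: ler_wpM2r => //.
  apply: ler_wpM2l => //; apply: le_trans (norm_mulmx _ _) _; apply: ler_wpM2l.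
    by rewrite mulr_ge0.
  by rewrite (le_trans Pb)// ler_norm.
pose Z := [set P | ursubmx (cj P) = 0].
have cj1 : cj 1%:M = block_mx 1%:M 0 0 1%:M.
  by rewrite /cj mulmx1 mulmxV// scalar_mx_block.
have Z1 : Z 1%:M by rewrite /Z /= cj1 block_mxKur.
have char_cj P : Z P -> char_poly P = char_poly (ulsubmx (cj P)) * char_poly (drsubmx (cj P)).
  by move=> ZP; rewrite -char_poly_lower_block// char_poly_conj.
apply: (exp_stable_conj Gu); rewrite -/cj -/Ac.
apply: (@exp_stable_lower_block _ _ Ac bc _ Acb) => [_ [M /cj0 ? <-] //||].
- apply: (IH _ _ `|bc|).
  + exact: Vn.
  + move=> _ [M /Acb Mb <-]; apply: norm_mx_le => // i j.
    by rewrite !mxE (le_trans (norm_mx_entry _ _ _))// (le_trans Mb)// ler_norm.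
  + rewrite /Ac image_comp; apply: (@contracting_image _ _ A Z) Arho => //.
    * by rewrite /= cj1 block_mxKul.
    * move=> M P ZM ZP; rewrite /Z /= cjM mul_lower_block//.
      by rewrite block_mxKur block_mxKul.
    * by move=> P ZP; rewrite (char_cj _ ZP) dvdp_mulr.
- apply: (IH _ _ `|bc|).
  + by rewrite -[X in (X < _)%N]add0n ltn_add2r.
  + move=> _ [M /Acb Mb <-]; apply: norm_mx_le => // i j.
    by rewrite !mxE (le_trans (norm_mx_entry _ _ _))// (le_trans Mb)// ler_norm.
  + rewrite /Ac image_comp; apply: (@contracting_image _ _ A Z) Arho => //.
    * by rewrite /= cj1 block_mxKdr.
    * move=> M P ZM ZP; rewrite /Z /= cjM mul_lower_block//.
      by rewrite block_mxKur block_mxKdr.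
    * by move=> P ZP; rewrite (char_cj _ ZP) dvdp_mull.
Qed.

End Blocks.

(** * Induction on the dimension *)

Section BergerWang.
Variable R : realType.
Implicit Types (n : nat) (a g : R).

Lemma bounded_orbit_subspace n (A : set 'M[R]_n) a :
  exists V : 'M[R]_n, forall x : 'rV[R]_n,
    (exists K, forall s, words A s -> `|x *m wprod a s| <= K) <-> (x <= V)%MS.
Proof.
apply: subspace_matrix.
  by exists 0 => s _; rewrite mul0mx normr0.
move=> c x y [K HK] [L HL]; exists (`|c| * K + L) => s As.
rewrite mulmxDl -scalemxAl; apply: le_trans (ler_normD _ _) _.
by rewrite mx_normZ lerD ?HL// ler_wpM2l ?HK.
Qed.

Lemma bounded_products n (A : set 'M[R]_n) a :
  (forall x : 'rV[R]_n, exists K, forall s, words A s -> `|x *m wprod a s| <= K) ->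
  exists K, forall s, words A s -> `|wprod a s| <= K.
Proof.
move=> orb; have /choice[K HK] i := orb (delta_mx 0 i : 'rV[R]_n).
exists (\sum_i `|K i|) => s As; apply: norm_mx_le => [|i j]; first exact: sumr_ge0.
rewrite (bigD1 i)//= ler_wpDr ?sumr_ge0//.
have := HK i s As; rewrite -rowE => /(le_trans (norm_mx_entry _ 0 j)).
by rewrite !mxE -/(wprod a s i j) => /le_trans; apply; exact: ler_norm.
Qed.

Theorem berger_wang n (A : set 'M[R]_n) b rho N : 0 <= rho < 1 ->
  (forall M, A M -> `|M| <= b) -> eventually_contracting A rho N -> exp_stable A.
Proof.
move=> rho01; have [m] := ubnP n; elim: m n A b => // m IH n A b nm Ab Arho.
apply: contrapT => nstable.
pose G := [set g : R | 0 < g /\ growth_le A g].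
have G1 g : G g -> 1 <= g.
  move=> [g0 Ag]; rewrite leNgt; apply/negP => g1; apply: nstable.
  by exists g => //; rewrite g0.
have infG : has_inf G.
  split; last by exists 1 => g /G1.
  exists (n%:R * `|b| + 1); split; first by rewrite ltr_wpDl// mulr_ge0.
  by apply: growth_le_bounded => // M /Ab Mb; rewrite (le_trans Mb)// ler_norm.
pose r := inf G.
have r1 : 1 <= r by apply: lb_le_inf; [case: infG | move=> g /G1].
have r0 : 0 < r by lra.
pose a := r^-1.
have a0 : 0 < a by rewrite invr_gt0.
have a1 : a <= 1 by rewrite invf_le1.
have [V HV] := bounded_orbit_subspace A a.
have [Vn|Vn] := leqP n (\rank V).
  have [x|K AK] := @bounded_products _ A a.
    by apply/HV; rewrite submx_full// /row_full eqn_leq rank_leq_row.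
  have a01 : 0 < a <= 1 by rewrite a0.
  have [C [g [/andP[g0 g1] Hg]]] := exp_decay_of_bounded a01 rho01 Arho AK.
  (* Decay of the normalised products at rate [g < 1] would give a growth rate below the infimum
     [r]. *)
  have : G (g * r).
    split; first by rewrite mulr_gt0.
    exists C => s As; have := Hg s As; rewrite (norm_wprod _ (ltW a0)) /a exprVn mulrC.
    by rewrite ler_pdivrMr ?exprn_gt0// -mulrA -exprMn.
  move=> /(ge_inf (proj2 infG)); rewrite -/r; apply/negP; rewrite -ltNge.
  by rewrite gtr_pMl.
have [V0|V0] := posnP (\rank V).
  have [|L HL] := @doubling _ _ A a.
    move=> x x0 K; apply: contrapT => noK.
    have /HV : exists K, forall s, words A s -> `|x *m wprod a s| <= K.
      by exists K => s As; rewrite leNgt; apply/negP => Ks; apply: noK; exists s.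
    move/eqP: V0; rewrite mxrank_eq0 => /eqP ->.
    by rewrite submx0 (negbTE x0).
  apply: (@not_doubling _ n A a L) HL; first by rewrite (leq_ltn_trans _ Vn).
  move=> c /andP[c0 c1].
  (* Some growth rate [g] lies below [r / c], so that [c * a * g <= 1]: the normalised products are
     subexponential. *)
  have rc : 0 < r / c - r by rewrite subr_gt0 ltr_pdivlMr// gtr_pMr.
  have [g [g0 [C HC]] gr] := inf_adherent rc infG.
  rewrite -/r addrC subrK in gr.
  have C0 := growth_le_ge0 HC.
  exists C => s As; rewrite (norm_wprod _ (ltW a0)) mulrA -exprMn.
  have ca0 : 0 < c * a by rewrite mulr_gt0.
  apply: le_trans (ler_wpM2l _ (HC s As)) _; first by rewrite exprn_ge0// ltW.
  have cag : c * a * g <= 1.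
    by rewrite mulrAC ler_pdivrMr// mul1r mulrC -ler_pdivlMr// ltW.
  by rewrite mulrCA -exprMn ler_piMr// exprn_ile1// mulr_ge0 ?(ltW ca0) ?(ltW g0).
apply: nstable; apply: (@exp_stable_invariant _ n A V b rho N) => //.
- move=> l A' b' ln; apply: IH; lia.
- by rewrite V0.
move=> M AM; apply/row_subP => i; rewrite row_mul; apply/HV.
have /HV[K HK] : (row i V <= V)%MS by exact: row_sub.
(* Up to the factor [a], the orbit of [row i V *m M] along [s] is that of [row i V] along
   [M :: s]. *)
exists (K / a) => s As; rewrite ler_pdivlMr// mulrC -mulmxA.
have /HK : words A (M :: s) by apply/words_cons.
rewrite /wprod mxprods_cons /= exprS -scalerA -!scalemxAr mx_normZ gtr0_norm//.
Qed.

End BergerWang.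

(** * From the joint spectral radius to geometric decay *)

Section JointSpectralRadius.
Import complex.
Variable R : realType.

(** The supremum dominates its set only once that set is known to be bounded; the sum of the moduli
    of the finitely many roots is a bound. *)
Lemma spectral_radius_ge n (M : 'M[R]_n) l :
  complex_eigenvalues M l -> cmod l <= spectral_radius M.
Proof.
move=> Ml; apply: ub_le_sup; last by exists l.
pose i : {rmorphism R -> complex.complex R} := complex.real_complex R.
have [zs Ezs] := closed_field_poly_normal (map_poly i (char_poly M)).
have lc : lead_coef (map_poly i (char_poly M)) != 0.
  by rewrite lead_coef_eq0 map_poly_eq0 monic_neq0// char_poly_monic.
exists (\sum_(z <- zs) cmod z) => _ [z Mz <-].
have zzs : z \in zs.
  have : root (map_poly i (char_poly M)) z by exact: Mz.
  by rewrite Ezs rootZ// root_prod_XsubC.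
by rewrite (big_rem z)//= lerDl sumr_ge0// => w _; exact: sqrtr_ge0.
Qed.

Lemma mxprod_words n (A : set 'M[R]_n) t s : words A s -> size s = t ->
  exists2 Ms : 'I_t -> 'M[R]_n, (forall i, A (Ms i)) & mxprod Ms = mxprods s.
Proof.
move=> As <-; exists (fun i => nth 0 s i) => [i|]; first by apply: As; rewrite mem_nth.
by rewrite /mxprods (big_nth 0) big_mkord.
Qed.

Lemma jsr_eventually_contracting n (A : set 'M[R]_n) rho : (jsr A <= rho%:E)%E -> rho < 1 ->
  exists N rho', 0 <= rho' < 1 /\ eventually_contracting A rho' N.
Proof.
move=> Arho rho1; pose r := (rho + 1) / 2.
have r1 : r < 1 by rewrite /r; lra.
have : (jsr A < r%:E)%E by apply: le_lt_trans Arho _; rewrite lte_fin /r; lra.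
move=> /ereal_inf_lt[_ [V [N _ NV] <-] supV].
(* The term of index [t] concerns words of length [t.+1]; the maximum covers a negative [r]. *)
exists N.+1, (Num.max 0 r); split; first by rewrite le_max lexx gt_max ltr01.
move=> s As; case sN : (size s) => [//|t]; rewrite ltnS => Nt l sl.
have [Ms AMs Es] := mxprod_words As sN.
have lx := spectral_radius_ge sl; set x := spectral_radius _ in lx.
have Ex : spectral_radius (mxprod Ms) = x by rewrite Es.
clearbody x.
have l0 : 0 <= cmod l by exact: sqrtr_ge0.
have xr : x `^ (t.+1%:R^-1) <= r.
  rewrite -lee_fin; apply: le_trans (ltW supV).
  apply: (@le_trans _ _ (ereal_sup [set ((spectral_radius (mxprod Ms)) `^ (t.+1%:R^-1))%:E
              | Ms in [set Ms : 'I_t.+1 -> 'M[R]_n | forall s, A (Ms s)]])).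
    apply: ereal_sup_ubound; exists Ms; first exact: AMs.
    by rewrite /= Ex.
  by apply: ereal_sup_ubound; exists t; first exact: NV.
rewrite (le_trans lx)// le_max; apply/orP.
have [x0|x0] := leP x 0; [by left|right; apply: (le_trans _ xr)].
have e1 : (t.+1%:R^-1 : R) <= 1 by rewrite invf_le1// ler1n.
have [x1|x1] := leP x 1; first by rewrite ger1_powR// x0.
have : 1 `^ (t.+1%:R^-1) <= x `^ (t.+1%:R^-1).
  by apply: ge0_ler_powR; rewrite // ?nnegrE// ltW.
rewrite powR1 => one; have := lt_le_trans r1 one.
by rewrite ltNge xr.
Qed.

Theorem jsr_lt1_exp_stable n (A : set 'M[R]_n) b rho : rho < 1 ->
  (forall M, A M -> `|M| <= b) -> (jsr A <= rho%:E)%E -> exp_stable A.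
Proof.
move=> rho1 Ab /jsr_eventually_contracting/(_ rho1)[N [rho' [rho01]]].
by move=> Acon; exact: (berger_wang rho01 Ab Acon).
Qed.

End JointSpectralRadius.

(** * The companion form of the model *)

Section BlockVectors.
Variable R : realType.

Lemma index_pairs (S T : eqType) (x : S) (y : T) (s : seq S) (t : seq T) :
  x \in s -> y \in t ->
  index (x, y) [seq (u, v) | u <- s, v <- t] = (index x s * size t + index y t)%N.
Proof.
move=> xs yt; elim: s xs => [//|u s IH]; rewrite inE /= index_cat.
have [->|xu] := eqVneq x u.
  by rewrite map_f// index_map// => v w [].
rewrite /= => xs; rewrite IH//.
have -> : ((x, y) \in [seq (u, v) | v <- t]) = false.
  by apply/negbTE/mapP => -[v _ [xu']]; rewrite xu' eqxx in xu.
by rewrite size_map addnA.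
Qed.

(** [Dmat] and [Emat] are given by integer positions, blocks by [mxvec_index]; the row-major formula
    links the two. *)
Lemma val_mxvec_index m n (i : 'I_m) (j : 'I_n) : mxvec_index i j = (i * n + j)%N :> nat.
Proof.
rewrite /mxvec_index /= /enum_rank [enum_rank_in]unlock /=.
rewrite insubdK; last first.
  by rewrite cardE [_ \in _]index_mem mem_enum.
have -> : enum {: 'I_m * 'I_n} = [seq (u, v) | u <- enum 'I_m, v <- enum 'I_n].
  by rewrite enumT unlock.
by rewrite index_pairs ?mem_enum// !index_enum_ord size_enum_ord.
Qed.

(** [gvec] is an instance by conversion. Indexing the blocks by [nat] allows a boundary value at
    [k.-1], one past the last block. *)
Definition block_vec p k (G : nat -> 'cV[R]_p) : 'cV[R]_((k.-1) * p) :=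
  (mxvec (\matrix_(a < k.-1, s < p) G a s ord0))^T.

Lemma block_vecE p k (G : nat -> 'cV[R]_p) (a : 'I_k.-1) (s : 'I_p) :
  block_vec k G (mxvec_index a s) 0 = G a s 0.
Proof. by rewrite mxE mxvecE mxE. Qed.

Lemma block_vecP p k (v w : 'cV[R]_((k.-1) * p)) :
  (forall a s, v (mxvec_index a s) 0 = w (mxvec_index a s) 0) -> v = w.
Proof. by move=> vw; apply/colP => i; case/mxvec_indexP: i. Qed.

Lemma eq_block_vec p k (G H : nat -> 'cV[R]_p) :
  (forall a, (a < k.-1)%N -> G a = H a) -> block_vec k G = block_vec k H.
Proof. by move=> GH; apply: block_vecP => a s; rewrite !block_vecE GH. Qed.

Lemma block_vecB p k (G H : nat -> 'cV[R]_p) :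
  block_vec k G - block_vec k H = block_vec k (fun a => G a - H a).
Proof.
by apply: block_vecP => a s; rewrite !(mxE, mxvecE).
Qed.

Lemma block_vecD p k (G H : nat -> 'cV[R]_p) :
  block_vec k G + block_vec k H = block_vec k (fun a => G a + H a).
Proof. by apply: block_vecP => a s; rewrite !(mxE, mxvecE). Qed.

(** [Dmat] is the forward difference on blocks; the hypothesis supplies the value after the last
    block, where the superdiagonal stops. *)
Lemma Dmat_block_vec p k (G : nat -> 'cV[R]_p) : G k.-1 = 0 ->
  Dmat R p k *m block_vec k G = block_vec k (fun a => G a.+1 - G a).
Proof.
move=> Gk; apply: block_vecP => a s; rewrite block_vecE.
have iE : nat_of_ord (mxvec_index a s) = (a * p + s)%N by exact: val_mxvec_index.
have vi := block_vecE G a s; move: (mxvec_index a s) => i in iE vi *.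
rewrite mxE (bigD1 i)//= mxE eqxx mulN1r vi.
rewrite (eq_bigr (fun j : 'I_(k.-1 * p) =>
    if (j == i + p :> nat)%N then block_vec k G j 0 else 0)); last first.
  move=> j ji; rewrite mxE eq_sym (negbTE ji).
  by case: eqP => _; rewrite ?mul1r ?mul0r.
rewrite -big_mkcondr /= addrC [RHS]mxE [X in _ = _ + X]mxE; congr (_ - _).
have [ak|ak] := ltnP a.+1 k.-1.
  rewrite (big_pred1 (mxvec_index (Ordinal ak) s)); first by rewrite block_vecE.
  move=> j /=; apply/andP/eqP => [[_ /eqP jE]|->].
    apply: ord_inj; rewrite jE iE val_mxvec_index /= mulSn; lia.
  have jE : nat_of_ord (mxvec_index (Ordinal ak) s) = (i + p)%N.
    by rewrite val_mxvec_index iE /= mulSn; lia.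
  rewrite jE eqxx; split => //; apply/eqP => /(congr1 (@nat_of_ord _)); rewrite jE.
  have := ltn_ord s; lia.
have -> : a.+1 = k.-1 by apply/eqP; rewrite eqn_leq ak ltn_ord.
rewrite Gk mxE big_pred0// => j; apply/negbTE; apply/negP => /andP[_ /eqP jE].
have := ltn_ord j; rewrite jE iE; have : (k.-1 * p <= a.+1 * p)%N by rewrite leq_mul2r ak orbT.
rewrite mulSn; lia.
Qed.

(** When [k.-1 = 0] there are no blocks and the product vanishes, whence the hypothesis. *)
Lemma Emat_block_vec p k (G : nat -> 'cV[R]_p) : (k.-1 = 0%N -> G 0%N = 0) ->
  (Emat R p k)^T *m block_vec k G = G 0%N.
Proof.
move=> G0; apply/colP => s; rewrite mxE.
rewrite (eq_bigr (fun j : 'I_(k.-1 * p) =>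
    if (j == s :> nat)%N then block_vec k G j 0 else 0)); last first.
  by move=> j _; rewrite !mxE; case: eqP => _; rewrite ?mul1r ?mul0r.
rewrite -big_mkcond /=.
have [k1|k1] := posnP k.-1.
  rewrite G0// mxE big_pred0// => j.
  by have : (j < 0)%N by apply: (leq_trans (ltn_ord j)); rewrite k1 mul0n.
rewrite (big_pred1 (mxvec_index (Ordinal k1) s)); first by rewrite block_vecE.
by move=> j; rewrite /= -(inj_eq (@ord_inj _)) val_mxvec_index.
Qed.

Lemma block_vec_surj p k (v : 'cV[R]_(k.-1 * p)) :
  exists G, G k.-1 = 0 /\ v = block_vec k G.
Proof.
exists (fun a => if insub a is Some b then \col_s v (mxvec_index b s) 0 else 0); split.
  by rewrite insubF// ltnn.
by apply: block_vecP => a s; rewrite block_vecE valK mxE.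
Qed.

Lemma block_vec_eq0 p k (G : nat -> 'cV[R]_p) :
  block_vec k G = 0 -> forall a, (a < k.-1)%N -> G a = 0.
Proof.
move=> G0 a ak; apply/colP => s.
by rewrite -(block_vecE G (Ordinal ak)) G0 !mxE.
Qed.

End BlockVectors.

Section Model.
Variable R : realType.
Variables (p k r : nat) (c : 'cV[R]_p) (f : nat -> 'cV[R]_p -> 'cV[R]_p).
Variables (f0inv : 'cV[R]_p -> 'cV[R]_p) (alpha : 'M[R]_(p, r)).
Variables (mu : 'cV[R]_r) (theta : 'cV[R]_p -> 'cV[R]_r).
Hypothesis k_gt0 : (0 < k)%N.
Hypothesis f0K : cancel (f 0%N) f0inv.
Hypothesis f0invK : cancel f0inv (f 0%N).
Hypothesis cE : c = alpha *m mu.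
Hypothesis pifunE : forall z, pifun k f z = alpha *m theta z.

Local Notation g := (gfun k f).

Lemma gfun_succ j z : (j < k)%N -> f j.+1 z = g j.+1 z - g j z.
Proof. by move=> jk; rewrite /gfun opprK [X in _ + X]big_ltn// addrC addrK. Qed.

Lemma gfun_last z : g k z = 0.
Proof. by rewrite /gfun big_geq// oppr0. Qed.

(* [zeta Y t a] is the paper's block zeta_(a+1) of the companion state; the truncated
   subtractions are exact as soon as [k.-1 <= t]. *)
Definition zeta (Y : nat -> 'cV[R]_p) t a : 'cV[R]_p :=
  \sum_(a.+1 <= j < k) g j (Y (t - (j - a))%N).

Lemma zeta_last Y t : zeta Y t k.-1 = 0.
Proof. by rewrite /zeta prednK// big_geq. Qed.

Lemma zeta_succ Y t a : (a < k.-1)%N -> zeta Y t.+1 a = g a.+1 (Y t) + zeta Y t a.+1.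
Proof.
move=> ak; rewrite /zeta big_ltn; last by rewrite -ltn_predRL.
rewrite subSnn subSS subn0; congr (_ + _); apply: eq_big_nat => j /andP[aj _].
by congr (g j (Y _)); lia.
Qed.

Definition companion_state (Y : nat -> 'cV[R]_p) t : 'cV[R]_(p + k.-1 * p) :=
  col_mx (f 0%N (Y t)) (block_vec k (zeta Y t)).

(** The shift by [mu] leaves increments unchanged and makes the zeros rest points of the companion
    recursion. *)
Definition drift (x : 'cV[R]_(p + k.-1 * p)) : 'cV[R]_(r + k.-1 * p) :=
  btheta k f theta (f0inv (usubmx x)) + bD0 R p k r *m x + col_mx mu 0.

Lemma driftE x : drift x =
  col_mx (theta (f0inv (usubmx x)) + mu) (gvec k f (f0inv (usubmx x)) + Dmat R p k *m dsubmx x).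
Proof.
rewrite /drift /btheta -[in bD0 _ _ _ _ *m x](vsubmxK x) mul_block_col !mul0mx addr0 add0r.
by rewrite !add_col_mx !addr0.
Qed.

Lemma drift_state Y t : drift (companion_state Y t) =
  col_mx (theta (Y t) + mu) (block_vec k (zeta Y t.+1) - block_vec k (zeta Y t)).
Proof.
rewrite driftE /companion_state col_mxKu col_mxKd f0K; congr col_mx.
rewrite Dmat_block_vec ?zeta_last// -[gvec _ _ _]/(block_vec k (fun a => g a.+1 (Y t))).
rewrite block_vecD block_vecB; apply: eq_block_vec => a ak.
by rewrite zeta_succ// addrA.
Qed.

(** Error-correction form. Writing each [f i.+1] as [g i.+1 - g i] turns the lags into an increment
    of [zeta], and the boundary term at lag 0 combines with [f 0] into [pifun], which is
    [alpha *m theta]. *)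
Lemma vecm Y t U :
  f 0%N (Y t.+1) = c + \sum_(i < k) f i.+1 (Y (t - i)%N) + U ->
  companion_state Y t.+1 =
    companion_state Y t + balpha k alpha *m drift (companion_state Y t) + col_mx U 0.
Proof.
move=> YE; rewrite drift_state mul_block_col mul0mx mul1mx add0r !add_col_mx /companion_state.
congr col_mx; last by rewrite addr0 addrCA subrr addr0.
have z0 t' : k.-1 = 0%N -> zeta Y t' 0 = 0 by move=> k1; rewrite -{2}k1 zeta_last.
rewrite mulmxBr !Emat_block_vec; try exact: z0.
rewrite mulmxDr -cE -pifunE /pifun {}YE.
have -> : \sum_(i < k) f i.+1 (Y (t - i)%N) =
    zeta Y t.+1 0 - zeta Y t 0 + \sum_(1 <= i < k.+1) f i (Y t).
  rewrite (eq_bigr (fun i : 'I_k => g i.+1 (Y (t - i)%N) - g i (Y (t - i)%N))); last first.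
    by move=> i _; rewrite gfun_succ.
  rewrite sumrB -(big_mkord xpredT (fun i => g i.+1 (Y (t - i)%N))).
  rewrite -(big_mkord xpredT (fun i => g i (Y (t - i)%N))).
  have -> : \sum_(0 <= i < k) g i.+1 (Y (t - i)%N) = zeta Y t.+1 0.
    rewrite -[in LHS](prednK k_gt0) big_nat_recr//= prednK// gfun_last addr0.
    by rewrite /zeta big_add1; apply: eq_bigr => i _; rewrite subn0 subSS.
  rewrite big_ltn// subn0 opprD addrA addrAC; congr (_ - _ + _).
    by rewrite /zeta; apply: eq_bigr => i _; rewrite subn0.
  by rewrite /gfun opprK.
set S := \sum_(1 <= i < k.+1) _; set F := f 0%N _.
by apply/colP => i; rewrite !mxE; ring.
Qed.

Lemma drift_companion_const z : theta z = - mu -> drift (companion_state (fun=> z) 0) = 0.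
Proof. by move=> zmu; rewrite drift_state zmu addNr /zeta subrr col_mx0. Qed.

(* The dynamics conserve the [alpha_perp] component of [level_mx *m x], up to the
   shock at time 0; at a rest point it is the [alpha_perp] component of h. *)
Definition level_mx : 'M[R]_(p, p + k.-1 * p) := row_mx 1%:M (- (Emat R p k)^T).

Lemma level_balpha : level_mx *m balpha k alpha = row_mx alpha 0.
Proof.
by rewrite /level_mx /balpha mul_row_block !mul1mx !mulmx0 !mulmx1 addr0 subrr.
Qed.

Lemma level_state Y t : level_mx *m companion_state Y t = f 0%N (Y t) - zeta Y t 0.
Proof.
rewrite mul_row_col mul1mx mulNmx Emat_block_vec// => k1.
by rewrite -{2}k1 zeta_last.
Qed.

Lemma level_companion_const z t : level_mx *m companion_state (fun=> z) t = hfun k f z.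
Proof. by rewrite level_state. Qed.

(** At a zero of [drift] the block differences are [G a.+1 - G a = - g a.+1]; telescoping from
    [G k.-1 = 0] identifies [G 0] with the sum of the [g a.+1]. *)
Lemma level_drift0 x : drift x = 0 -> level_mx *m x = hfun k f (f0inv (usubmx x)).
Proof.
rewrite driftE -[X in _ = X]col_mx0 => /eq_col_mx[_].
have [G [Gk GE]] := block_vec_surj (dsubmx x).
rewrite GE Dmat_block_vec// -[gvec _ _ _]/(block_vec k (fun a => g a.+1 (f0inv (usubmx x)))).
rewrite block_vecD => /block_vec_eq0 gG.
rewrite -[x in LHS]vsubmxK GE mul_row_col mul1mx mulNmx Emat_block_vec; last first.
  by move=> k1; move: Gk; rewrite k1.
rewrite /hfun f0invK; congr (_ - _).
rewrite big_add1 (eq_big_nat _ _ (F2 := fun a => - (G a.+1 - G a))); last first.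
  by move=> a ak; apply/eqP; rewrite -addr_eq0; apply/eqP/gG.
by rewrite sumrN telescope_sumr// Gk sub0r opprK.
Qed.

(** Initial values, oldest first, followed by the trajectory: index [k + n] is time [n], so all lags
    are natural numbers. *)
Definition path_of (u : 'cV[R]_p) (zz : 'I_k -> 'cV[R]_p) (m : nat) : 'cV[R]_p :=
  if (m < k)%N then (if insub (k.-1 - m)%N is Some i then zz i else 0)
  else traj c f f0inv u zz (m - k).

Lemma path_of_hist u zz n (i : 'I_k) :
  hist c f f0inv u zz n i = path_of u zz (k.-1 + n - i)%N.
Proof.
elim: n i => [|n IH] i /=.
  have ik := ltn_ord i; rewrite /path_of ifT; last by lia.
  have -> : (k.-1 - (k.-1 + 0 - i))%N = i by lia.
  by rewrite valK.
have [i0|i0] := eqVneq (i : nat) 0%N.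
  rewrite /path_of ifF; last by lia.
  by have -> : (k.-1 + n.+1 - i - k)%N = n by lia.
rewrite IH; congr path_of => /=; have := ltn_ord i; lia.
Qed.

End Model.

(** * Recursions with linear feedback *)

Section LinearFeedback.
Variable R : realType.
Variables (N m : nat) (F : 'cV[R]_N -> 'cV[R]_m) (P : 'M[R]_(N, m)).
Variables (B : set 'M[R]_(N, m)) (b : R).
Hypothesis Bb : forall beta, B beta -> `|beta| <= b.
Hypothesis FB : forall x y, exists2 beta, B beta & F x - F y = beta^T *m (x - y).
Hypothesis AB : exp_stable [set 1%:M + beta^T *m P | beta in B].

Lemma norm_feedback x y : `|F x - F y| <= N%:R * `|b| * `|x - y|.
Proof.
have [beta /Bb bb ->] := FB x y; apply: le_trans (norm_mulmx _ _) _.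
apply: ler_wpM2r => //; apply: ler_wpM2l => //; apply: norm_mx_le => // i j.
by rewrite mxE (le_trans (norm_mx_entry _ _ _))// (le_trans bb)// ler_norm.
Qed.

(** Such a [v] is fixed by some [1 + beta^T *m P], whose powers tend to 0. *)
Lemma feedback_inj x v : F (x + P *m v) = F x -> v = 0.
Proof.
have [beta Bbeta] := FB (x + P *m v) x; rewrite addrAC subrr add0r => E /eqP.
rewrite -subr_eq0 E mulmxA => /eqP fix0; have [g /andP[g0 g1] [C HC]] := AB.
have C0 := growth_le_ge0 HC; pose M := 1%:M + beta^T *m P.
have Mv t : mxprods (nseq t M) *m v = v.
  elim: t => [|t IH]; first by rewrite mxprods_nil mul1mx.
  by rewrite /= mxprods_cons -mulmxA IH mulmxDl mul1mx fix0 addr0.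
have bnd t : `|v| <= m%:R * C * `|v| * g ^+ t.
  rewrite -[in X in X <= _](Mv t); apply: le_trans (norm_mulmx _ _) _.
  rewrite [X in _ <= X]mulrAC -[X in _ <= X * _]mulrA.
  apply: ler_wpM2r => //; apply: ler_wpM2l => //.
  have := HC (nseq t M); rewrite size_nseq; apply => _ /nseqP[-> _].
  by exists beta.
apply/eqP; rewrite -normr_le0.
apply: (@ler_cvg_to _ \oo _ R (fun=> `|v|) (fun t => m%:R * C * `|v| * g ^+ t)).
- exact: cvg_cst.
- rewrite -[X in _ --> X](mulr0 (m%:R * C * `|v|)); apply: cvgMr.
  by apply: cvg_expr; rewrite gtr0_norm.
- by apply: nearW => t; exact: bnd.
Qed.

(** The values [F (X n)] are multiplied at each step by some [1 + beta^T *m P], so they decay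
    geometrically. The increments of [X] are then summable, and [F], being Lipschitz, vanishes at
    the limit. *)
Lemma feedback_cvg (X : nat -> 'cV[R]_N) :
  (forall n, X n.+1 = X n + P *m F (X n)) ->
  exists x, X @ \oo --> x /\ F x = 0.
Proof.
move=> XE; have [g /andP[g0 g1] [C HC]] := AB; have C0 := growth_le_ge0 HC.
have [s sP] : exists s : nat -> seq 'M[R]_m, forall n,
    [/\ words [set 1%:M + beta^T *m P | beta in B] (s n), size (s n) = n &
        F (X n) = mxprods (s n) *m F (X 0%N)].
  suff /choice[s sP] : forall n, exists s : seq 'M[R]_m,
    [/\ words [set 1%:M + beta^T *m P | beta in B] s, size s = n &
        F (X n) = mxprods s *m F (X 0%N)] by exists s.
  elim=> [|n [s [As sn Fs]]].
    by exists [::]; split => //; rewrite mxprods_nil mul1mx.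
  have dX : X n.+1 - X n = P *m F (X n) by rewrite XE addrAC subrr add0r.
  have [beta Bbeta] := FB (X n.+1) (X n); rewrite dX => /eqP; rewrite subr_eq => /eqP FX.
  exists ((1%:M + beta^T *m P) :: s); split; rewrite /= ?sn//.
    by apply/words_cons; split => //; exists beta.
  by rewrite mxprods_cons -mulmxA -Fs FX mulmxDl mul1mx mulmxA addrC.
pose D := m%:R * C * `|F (X 0%N)|.
have D0 : 0 <= D by rewrite !mulr_ge0.
have FXn n : `|F (X n)| <= D * g ^+ n.
  have [As sn ->] := sP n; apply: le_trans (norm_mulmx _ _) _.
  rewrite /D [X in _ <= X]mulrAC -[X in _ <= X * _]mulrA.
  apply: ler_wpM2r => //; apply: ler_wpM2l => //.
  by have := HC _ As; rewrite sn.
have gn : `|g| < 1 by rewrite gtr0_norm.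
pose u n := P *m F (X n).
have uX n : series u n = X n - X 0%N.
  rewrite /series /= (eq_bigr (fun i => X i.+1 - X i)); last first.
    by move=> i _; rewrite XE addrAC subrr add0r.
  by rewrite telescope_sumr.
have : cvgn (series u).
  suff /cauchy_cvgP/cauchy_seriesP uC : cvgn [normed series u].
    apply/(@cauchy_cvgP 'cV[R]_N)/(@cauchy_seriesP R 'cV[R]_N) => e /uC.
    apply: filterS => n /=; rewrite ger0_norm ?sumr_ge0//.
    by apply: le_lt_trans; exact: ler_norm_sum.
  apply: (@series_le_cvg _ _ (geometric (m%:R * `|P| * D) g)).
  - by move=> n; exact: normr_ge0.
  - by move=> n /=; rewrite mulr_ge0 ?exprn_ge0 ?(ltW g0)// !mulr_ge0.
  - move=> n; apply: le_trans (norm_mulmx _ _) _; rewrite /= -[X in _ <= X]mulrA.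
    by apply: ler_wpM2l; [rewrite mulr_ge0 | exact: FXn].
  - exact: is_cvg_geometric_series.
move=> /cvg_ex[l ul]; exists (l + X 0%N).
have Xl : X @ \oo --> l + X 0%N.
  have : (fun n => series u n + X 0%N) @ \oo --> l + X 0%N.
    by apply: cvgD; [exact: ul | exact: cvg_cst].
  by under eq_fun do rewrite uX subrK.
split => //; apply/eqP; rewrite -normr_le0.
set x := l + X 0%N in Xl *.
apply: (@ler_cvg_to _ \oo _ R (fun=> `|F x|)
    (fun n => N%:R * `|b| * `|x - X n| + D * g ^+ n)).
- exact: cvg_cst.
- rewrite -[X in _ --> X]addr0; apply: cvgD.
    rewrite -[X in _ --> X](mulr0 (N%:R * `|b|)); apply: cvgMr.
    rewrite -(normr0 'cV[R]_N) -[X in `|X|](subrr x).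
    by apply: cvg_norm; apply: cvgB; [exact: cvg_cst | exact: Xl].
  rewrite -[X in _ --> X](mulr0 D); apply: cvgMr; exact: cvg_expr.
- apply: nearW => n; rewrite -[F x](subrK (F (X n))).
  by rewrite (le_trans (ler_normD _ _))// lerD// norm_feedback.
Qed.

End LinearFeedback.

(** * Limits, domains of attraction and strict stability *)

Lemma mulmx_cvg (R : realType) m n p (T : Type) (F : set_system T)
    (A : 'M[R]_(m, n)) (u : T -> 'M[R]_(n, p))
    (l : 'M[R]_(n, p)) :
  u @ F --> l -> (fun t => A *m u t) @ F --> A *m l.
Proof. by move=> ul; apply: (cvg_comp _ _ ul); exact: mulmx_continuous. Qed.

Lemma mx_cvg_unique (R : realType) m n (v : nat -> 'M[R]_(m, n))
    (x y : 'M[R]_(m, n)) :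
  v @ \oo --> x -> v @ \oo --> y -> x = y.
Proof. by move=> vx vy; apply: (@cvg_unique _ _ (v @ \oo)) vx vy; exact: norm_hausdorff. Qed.

(** The span of [alpha] lies in the kernel of [alpha_perp^T], and both have dimension [r]. *)
Lemma orthogonal_span (R : realType) p r (alpha : 'M[R]_(p, r)) (alpha_perp : 'M[R]_(p, p - r)) v :
  \rank alpha = r -> \rank alpha_perp = (p - r)%N -> alpha_perp^T *m alpha = 0 ->
  alpha_perp^T *m v = 0 -> exists a : 'cV[R]_r, v = alpha *m a.
Proof.
move=> ra rp ap0 pv0.
have rle : (r <= p)%N by rewrite -ra rank_leq_row.
have sub : (alpha^T <= kermx alpha_perp)%MS.
  by apply/sub_kermxP; rewrite -[alpha_perp]trmxK -trmx_mul ap0 trmx0.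
have ker_alpha : (kermx alpha_perp <= alpha^T)%MS.
  by rewrite -(geq_leqif (mxrank_leqif_sup sub)) mxrank_ker rp mxrank_tr ra subKn.
have : (v^T <= kermx alpha_perp)%MS.
  by apply/sub_kermxP; rewrite -[alpha_perp]trmxK -trmx_mul pv0 trmx0.
move=> /submx_trans/(_ ker_alpha)/submxP[a va]; exists a^T.
by apply: trmx_inj; rewrite va trmx_mul trmxK.
Qed.

Section Path.
Variable R : realType.
Implicit Types (p k r : nat).

Lemma path_of_traj p k (k_gt0 : (0 < k)%N) (c : 'cV[R]_p) f f0inv u (zz : 'I_k -> 'cV[R]_p) n :
  cancel f0inv (f 0%N) ->
  f 0%N (path_of c f f0inv u zz (k.-1 + n).+1) =
  c + \sum_(i < k) f i.+1 (path_of c f f0inv u zz (k.-1 + n - i)%N)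
    + (if n == 0%N then u else 0).
Proof.
move=> f0invK; have -> : (k.-1 + n).+1 = (k + n)%N by lia.
rewrite {1}/path_of ltnNge leq_addr /= addKn /traj /next_val f0invK.
by congr (_ + _ + _); apply: eq_bigr => i _; rewrite path_of_hist.
Qed.

(** Index [k.-1] is the last one before the shock, so this state involves the initial values
    only. *)
Lemma level_initial p k (k_gt0 : (0 < k)%N) (c : 'cV[R]_p) f f0inv u (zz : 'I_k -> 'cV[R]_p) :
  level_mx R p k *m companion_state k f (path_of c f f0inv u zz) k.-1 = hbar f zz k_gt0.
Proof.
have pathE (i : 'I_k) : path_of c f f0inv u zz (k.-1 - i)%N = zz i.
  by rewrite -[k.-1]addn0 -path_of_hist.
rewrite level_state//; congr (f 0%N _ - _).
  by have := pathE (Ordinal k_gt0); rewrite subn0.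
rewrite /zeta big_geq_mkord; apply: eq_bigr => i _.
by rewrite subn0 pathE.
Qed.

End Path.

Theorem theorem4p1 (R : realType) (p k r : nat) (k_gt0 : (0 < k)%N)
  (c : 'cV[R]_p) (f : nat -> 'cV[R]_p -> 'cV[R]_p)
  (f0inv : 'cV[R]_p -> 'cV[R]_p)
  (alpha : 'M[R]_(p, r)) (alpha_perp : 'M[R]_(p, p - r))
  (mu : 'cV[R]_r) (theta : 'cV[R]_p -> 'cV[R]_r)
  (bbar rhobar : R) (B : set 'M[R]_(p + (k.-1) * p, r + (k.-1) * p)) :
  (1 <= p)%N -> (r < p)%N ->
  (* f_i(0) = 0 *)
  (forall i, (i <= k)%N -> f i 0 = 0) ->
  (* alpha of rank r, alpha_perp of rank p - r with alpha_perp^T alpha = 0 *)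
  \rank alpha = r -> \rank alpha_perp = (p - r)%N -> alpha_perp^T *m alpha = 0 ->
  (* (i) f_0 is a homeomorphism, with inverse f0inv *)
  homeomorphism_with (f 0%N) f0inv ->
  (* (ii) c = alpha mu, pi = alpha theta *)
  c = alpha *m mu ->
  (forall z, pifun k f z = alpha *m theta z) ->
  (* (iii) *)
  rhobar < 1 ->
  closed B ->
  (forall beta, B beta -> `|beta| <= bbar) ->
  (jsr [set (1%:M + beta^T *m balpha k alpha)%R | beta in B] <= rhobar%:E)%E ->
  (forall zb zb' : 'cV[R]_(p + (k.-1) * p),
     exists2 beta, B beta &
       (btheta k f theta (f0inv (usubmx zb)) + bD0 R p k r *m zb)
       - (btheta k f theta (f0inv (usubmx zb')) + bD0 R p k r *m zb')
       = beta^T *m (zb - zb')) ->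
  (* (1) convergence to chi^{-1}(alpha_perp^T [hbar(zz) + u]; -mu), in M_mu *)
  (forall (u : 'cV[R]_p) (zz : 'I_k -> 'cV[R]_p),
     exists zinf : 'cV[R]_p,
       [/\ chi k f alpha_perp theta zinf
             = col_mx (alpha_perp^T *m (hbar f zz k_gt0 + u)) (- mu),
           (forall y, chi k f alpha_perp theta y
                      = col_mx (alpha_perp^T *m (hbar f zz k_gt0 + u)) (- mu) ->
                      y = zinf),
           traj c f f0inv u zz @ \oo --> zinf
         & theta zinf = - mu]) /\
  (* (2) span alpha + [h(z) - hbar(zz)] is the domain of attraction *)
  (forall (z : 'cV[R]_p) (zz : 'I_k -> 'cV[R]_p), theta z = - mu ->
     domain_of_attraction c f f0inv z zz
     = [set u | exists a : 'cV[R]_r, u = alpha *m a + (hfun k f z - hbar f zz k_gt0)]) /\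
  (* hence M_mu is strictly stable *)
  strictly_stable k c f f0inv [set z | theta z = - mu].
Proof.
move=> p_gt0 rp f00 ralpha rperp perp0 [f0K [f0invK [f0c f0invc]]] cE pifunE rho1 _ Bb jsrB FB.
pose A := [set (1%:M + beta^T *m balpha k alpha)%R | beta in B].
have AB : exp_stable A.
  apply: (jsr_lt1_exp_stable rho1 _ jsrB) => _ [beta /Bb bb <-].
  apply: le_trans (ler_normD _ _) _; apply: lerD; first exact: lexx.
  apply: le_trans (norm_mulmx _ _) _; apply: ler_wpM2r => //; apply: ler_wpM2l => //.
  apply: (@norm_mx_le _ _ _ _ `|bbar|) => // i j.
  by rewrite mxE (le_trans (norm_mx_entry _ _ _))// (le_trans bb)// ler_norm.
pose F := drift (k := k) f f0inv mu theta.
have FB' x y : exists2 beta, B beta & F x - F y = beta^T *m (x - y).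
  have [beta Bbeta E] := FB x y; exists beta; rewrite -?E //.
  by rewrite /F /drift opprD addrACA subrr addr0.
pose L := level_mx R p k.
(* [L] sends the range of [balpha] into the span of [alpha], so the feedback never moves the
   [alpha_perp] component of the level. *)
have perpL x : alpha_perp^T *m (L *m (balpha k alpha *m x)) = 0.
  by rewrite [L *m _]mulmxA level_balpha mulmxA mul_mx_row perp0 mulmx0 row_mx0 mul0mx.
have fixed_inj x y : F x = 0 -> F y = 0 ->
    alpha_perp^T *m (L *m x) = alpha_perp^T *m (L *m y) -> x = y.
  move=> Fx Fy /eqP; rewrite -subr_eq0 -!mulmxBr => /eqP.
  move=> /(orthogonal_span ralpha rperp perp0)[a].
  move=> La; apply/eqP; rewrite -subr_eq0; apply/eqP.
  (* Since [L] is the row [1, - E^T], the difference has upper block [alpha *m a] plus [E^T] times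
     its lower block, and so lies in the range of [balpha]. *)
  have xy : x - y = balpha k alpha *m col_mx a (dsubmx (x - y)).
    move: La; set d := x - y; rewrite -[in L *m d](vsubmxK d) mul_row_col mul1mx mulNmx.
    move=> /eqP; rewrite subr_eq => /eqP du.
    by rewrite mul_block_col mul0mx add0r mul1mx -du vsubmxK.
  have v0 : col_mx a (dsubmx (x - y)) = 0.
    apply: (feedback_inj FB' AB (x := y)).
    by rewrite -xy addrC subrK Fx Fy.
  by rewrite xy v0 mulmx0.
have chi_inj y z : theta y = - mu -> theta z = - mu ->
    alpha_perp^T *m hfun k f y = alpha_perp^T *m hfun k f z -> y = z.
  move=> ymu zmu yz.
  have := fixed_inj _ _ (drift_companion_const k_gt0 f0K ymu) (drift_companion_const k_gt0 f0K zmu).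
  rewrite /L !level_companion_const// => /(_ yz) /eq_col_mx[fyz _].
  exact: (can_inj f0K).
have limit (u : 'cV[R]_p) (zz : 'I_k -> 'cV[R]_p) : exists zinf : 'cV[R]_p,
    [/\ alpha_perp^T *m hfun k f zinf = alpha_perp^T *m (hbar f zz k_gt0 + u),
        traj c f f0inv u zz @ \oo --> zinf & theta zinf = - mu].
  pose Y := path_of c f f0inv u zz.
  (* Starting at index [k], just after the shock, makes the recursion autonomous; [u] enters only
     through the level of [X 0]. *)
  pose X n := companion_state k f Y (k.-1 + n).+1.
  have rec n := path_of_traj k_gt0 c u zz n f0invK.
  have XS n : X n.+1 = X n + balpha k alpha *m F (X n).
    have := vecm k_gt0 f0K cE pifunE (rec n.+1).
    by rewrite /= col_mx0 addr0 /X /Y addnS.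
  have X0 : L *m X 0%N = L *m (balpha k alpha *m F (companion_state k f Y k.-1)) + (hbar f zz k_gt0 + u).
    have := vecm k_gt0 f0K cE pifunE (rec 0%N); rewrite /= addn0 => XE.
    rewrite /X addn0 XE !mulmxDr level_initial addrC addrA addrC; congr (_ + _).
    by rewrite addrC mul_row_col mul1mx mulmx0 addr0.
  have [x [Xx Fx]] := feedback_cvg Bb FB' AB XS.
  have LX n : alpha_perp^T *m (L *m X n) = alpha_perp^T *m (hbar f zz k_gt0 + u).
    elim: n => [|n IH]; first by rewrite X0 mulmxDr perpL add0r.
    by rewrite XS (mulmxDr L) (mulmxDr alpha_perp^T) perpL addr0.
  have Lx : alpha_perp^T *m (L *m x) = alpha_perp^T *m (hbar f zz k_gt0 + u).
    apply: (@mx_cvg_unique _ _ _ (fun n => alpha_perp^T *m (L *m X n))).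
      by apply: mulmx_cvg; exact: mulmx_cvg.
    by under eq_fun do rewrite LX; exact: cvg_cst.
  exists (f0inv (usubmx x)); split.
  - by rewrite -(level_drift0 f0invK Fx).
  - have -> : traj c f f0inv u zz = (fun n => f0inv (usubmx (X n))).
      apply/funext => n; rewrite /X /companion_state col_mxKu f0K /Y /path_of.
      by rewrite ifF; [congr traj|]; lia.
    apply: continuous_cvg; first exact: f0invc.
    have usubE (v : 'cV[R]_(p + k.-1 * p)) : usubmx v = row_mx 1%:M 0 *m v.
      by rewrite -[in RHS](vsubmxK v) mul_row_col mul1mx mul0mx addr0.
    under eq_fun do rewrite usubE.
    by rewrite usubE; exact: mulmx_cvg.
  - move: Fx; rewrite /F driftE -[X in _ = X]col_mx0 => /eq_col_mx[/eqP].
    by rewrite addr_eq0 => /eqP.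
have part1 (u : 'cV[R]_p) (zz : 'I_k -> 'cV[R]_p) : exists zinf : 'cV[R]_p,
    [/\ chi k f alpha_perp theta zinf = col_mx (alpha_perp^T *m (hbar f zz k_gt0 + u)) (- mu),
        (forall y, chi k f alpha_perp theta y
           = col_mx (alpha_perp^T *m (hbar f zz k_gt0 + u)) (- mu) -> y = zinf),
        traj c f f0inv u zz @ \oo --> zinf & theta zinf = - mu].
  have [z [hz tz zmu]] := limit u zz; exists z; split => //.
    by rewrite /chi hz zmu.
  by move=> y /eq_col_mx[hy ymu]; apply: chi_inj => //; rewrite hy hz.
have part2 z (zz : 'I_k -> 'cV[R]_p) : theta z = - mu -> domain_of_attraction c f f0inv z zz
    = [set u | exists a : 'cV[R]_r, u = alpha *m a + (hfun k f z - hbar f zz k_gt0)].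
  move=> zmu; apply/seteqP; split => [u tz|_ [a ->]] /=; last first.
    rewrite /domain_of_attraction /=; set u := _ + _.
    have [z' [hz' tz' zmu']] := limit u zz; suff -> : z = z' by [].
    apply: chi_inj => //; rewrite hz' /u addrCA [hbar _ _ _ + (_ - _)]addrC subrK.
    by rewrite [RHS]mulmxDr mulmxA perp0 mul0mx add0r.
  have [z' [hz' tz' zmu']] := limit u zz; rewrite -(mx_cvg_unique tz tz') in hz'.
  (* Equal [alpha_perp] levels mean that [u] and [hfun k f z - hbar f zz k_gt0] differ by an element
     of the span of [alpha]. *)
  have [|a Ea] := orthogonal_span (v := u - (hfun k f z - hbar f zz k_gt0)) ralpha rperp perp0.
    by rewrite opprB addrA mulmxBr hz' [u + _]addrC subrr.
  by exists a; rewrite -Ea subrK.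
split; first exact: part1; split; first exact: part2.
split=> [u zz|z zmu zz]; first by have [z [_ _ tz zmu]] := part1 u zz; exists z.
exists (domain_of_attraction c f f0inv z zz); split; last by [].
rewrite part2//; exists (hfun k f z - hbar f zz k_gt0); exists 0.
by rewrite mulmx0 add0r.
Qed.
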